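(* Let $\lambda\in(0,1/2)$ and let $f\in\mathrm{BMO}(\mathbb{R}^n)$. Then $f\in\mathrm{CMO}(\mathbb{R}^n)$ if and only if the following three conditions hold: (1) $\lim_{r\to0}\sup_{|Q|=r}\overline{a}_\lambda(f;Q)=0$; (2) $\lim_{r\to\infty}\sup_{|Q|=r}\overline{a}_\lambda(f;Q)=0$; (3) $\lim_{d\to\infty}\sup_{Q\cap[-d,d]^n=\emptyset}\overline{a}_\lambda(f;Q)=0$. Here the suprema are over cubes $Q\subset\mathbb{R}^n$ with the indicated property.
   Context: Functions are complex-valued; cubes have sides parallel to the axes. $\mathrm{BMO}(\mathbb{R}^n)$ is the space of $f\in L^1_{loc}(\mathbb{R}^n)$ with $\|f\|_{\mathrm{BMO}}:=\sup_Q \frac1{|Q|}\int_Q|f(x)-f_Q|\,dx<\infty$, $f_Q=\frac1{|Q|}\int_Q f$. $\mathrm{CMO}(\mathbb{R}^n)$ is the closure of $C_c^\infty(\mathbb{R}^n)$ in the $\mathrm{BMO}(\mathbb{R}^n)$ topology. The non-increasing rearrangement of a measurable function $g$ is $g^*(t):=\inf\{\alpha>0:|\{x\in\mathbb{R}^n:|g(x)|>\alpha\}|<t\}$, $t\in(0,\infty)$. The local mean oscillation of a complex-valued measurable $f$ over a cube $Q$ is $$\overline{a}_\lambda(f;Q):=\inf_{c\in\mathbb{C}}\big((f-c)\chi_Q\big)^*(\lambda|Q|).$$ *)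

(* Defs.v *)
(* Points of R^n are row vectors 'rV[R]_n; complex numbers are R[i], with the
   real-valued modulus [Normc.normc]. *)
From HB Require Import structures.
From mathcomp Require Import all_boot all_order all_algebra.
From mathcomp Require Import all_classical all_reals all_analysis.
From mathcomp Require Import complex.
Set Implicit Arguments.
Unset Strict Implicit.
Unset Printing Implicit Defensive.
Import Order.TTheory GRing.Theory Num.Theory.
Import numFieldNormedType.Exports.
Local Open Scope classical_set_scope.
Local Open Scope ring_scope.
Local Open Scope complex_scope.

(* The Borel sigma-algebra of R^n, generated by the coordinates, as for the
   n.-tuple types of the library. *)
Section measurable_rV.
Context {R : realType} (n : nat).

Let coors : 'I_n -> 'rV[R]_n -> R := fun i x => x ord0 i.

Let rV_set0 : g_sigma_preimage coors set0.
Proof. exact: sigma_algebra0. Qed.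

Let rV_setC A : g_sigma_preimage coors A -> g_sigma_preimage coors (~` A).
Proof. exact: sigma_algebraC. Qed.

Let rV_bigcup (F : _^nat) : (forall i, g_sigma_preimage coors (F i)) ->
  g_sigma_preimage coors (\bigcup_i (F i)).
Proof. exact: sigma_algebra_bigcup. Qed.

HB.instance Definition _ := @isMeasurable.Build default_measure_display
  'rV[R]_n (g_sigma_preimage coors) rV_set0 rV_setC rV_bigcup.

End measurable_rV.

Lemma measurable_coord {R : realType} n (i : 'I_n) :
  measurable_fun [set: 'rV[R]_n] (fun x : 'rV[R]_n => x ord0 i).
Proof.
move=> _ Y mY; rewrite setTI; apply: sub_sigma_algebra => /=.
rewrite -bigcup_seq/=; exists i => /=; first by rewrite mem_index_enum.
by exists Y => //; rewrite setTI.
Qed.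

Lemma measurable_fun_coordP {R : realType} d (T : measurableType d) n
    (f : T -> 'rV[R]_n) :
  (forall i, measurable_fun [set: T] (fun x => f x ord0 i)) ->
  measurable_fun [set: T] f.
Proof.
move=> mf.
suff H : g_sigma_preimage (fun (i : 'I_n) x => f x ord0 i) `<=` measurable.
  move=> _ A mA; rewrite setTI; apply: H.
  rewrite (_ : (fun _ _ => _) = (fun i => (fun x : 'rV[R]_n => x ord0 i) \o f))//.
  by rewrite g_sigma_preimage_comp; exists A => //; rewrite setTI.
apply: smallest_sub; first exact: sigma_algebra_measurable.
rewrite -bigcup_seq; apply: bigcup_sub => i _ A [B mB <-].
exact: mf.
Qed.

(* R^(n+1) as the product of R and R^n. *)
Definition cons_row {R : realType} n (p : R * 'rV[R]_n) : 'rV[R]_n.+1 :=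
  row_mx (const_mx p.1 : 'rV[R]_1) p.2.

Definition uncons_row {R : realType} n (x : 'rV[R]_n.+1) : R * 'rV[R]_n :=
  (x ord0 ord0, \row_j x ord0 (lift ord0 j)).

Lemma cons_row0 {R : realType} n (p : R * 'rV[R]_n) :
  cons_row p ord0 ord0 = p.1.
Proof.
have := @row_mxEl R 1 1 n (const_mx p.1) p.2 ord0 ord0.
by rewrite [RHS]mxE => <-; congr (row_mx _ _ _ _); exact/val_inj.
Qed.

Lemma cons_rowS {R : realType} n (p : R * 'rV[R]_n) (j : 'I_n) :
  cons_row p ord0 (lift ord0 j) = p.2 ord0 j.
Proof.
have := @row_mxEr R 1 1 n (const_mx p.1) p.2 ord0 j.
by move=> <-; congr (row_mx _ _ _ _); exact/val_inj.
Qed.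

Lemma cons_rowK {R : realType} n : cancel (@cons_row R n) (@uncons_row R n).
Proof.
move=> p; rewrite /uncons_row cons_row0 [RHS]surjective_pairing; congr pair.
by apply/rowP => j; rewrite mxE cons_rowS.
Qed.

Lemma measurable_cons_row {R : realType} n :
  measurable_fun setT (@cons_row R n).
Proof.
apply: measurable_fun_coordP => i; case: (unliftP ord0 i) => [j ->|->].
- under eq_fun do rewrite cons_rowS.
  exact: (measurableT_comp (measurable_coord j) measurable_snd).
- by under eq_fun do rewrite cons_row0; exact: measurable_fst.
Qed.

Lemma measurable_uncons_row {R : realType} n :
  measurable_fun setT (@uncons_row R n).
Proof.
apply: measurable_fun_pair; first exact: measurable_coord.
apply: measurable_fun_coordP => i; under eq_fun do rewrite mxE.
exact: measurable_coord.
Qed.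

Section borel_lebesgue_step.
Context {R : realType} (n : nat).
Variable mu : {sigma_finite_measure set 'rV[R]_n -> \bar R}.

Definition borel_lebesgueS : set 'rV[R]_n.+1 -> \bar R :=
  pushforward (@lebesgue_measure R \x mu)%E (@cons_row R n).

Let borel_lebesgueS0 : borel_lebesgueS set0 = 0%E.
Proof. by rewrite /borel_lebesgueS /pushforward preimage_set0 measure0. Qed.

Let borel_lebesgueS_ge0 A : (0 <= borel_lebesgueS A)%E.
Proof. by rewrite /borel_lebesgueS /pushforward measure_ge0. Qed.

Let borel_lebesgueS_sigma_additive : semi_sigma_additive borel_lebesgueS.
Proof.
move=> F mF tF mUF.
have mc A : measurable A -> measurable (@cons_row R n @^-1` A).
  by move=> mA; rewrite -[X in measurable X]setTI; exact: measurable_cons_row.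
rewrite /borel_lebesgueS /pushforward preimage_bigcup.
apply: measure_semi_sigma_additive.
- by move=> k; exact: mc.
- apply/trivIsetP => /= i j _ _ ij; rewrite -preimage_setI.
  by move/trivIsetP : tF => /(_ _ _ _ _ ij) ->//; rewrite preimage_set0.
- by rewrite -preimage_bigcup; exact: mc.
Qed.

HB.instance Definition _ := isMeasure.Build _ _ _ borel_lebesgueS
  borel_lebesgueS0 borel_lebesgueS_ge0 borel_lebesgueS_sigma_additive.

Let borel_lebesgueS_sigma_finite : sigma_finite setT borel_lebesgueS.
Proof.
have /sigma_finiteP[F [TF ndF Foo]] := sigma_finiteT (@lebesgue_measure R).
have /sigma_finiteP[G [TG ndG Goo]] := sigma_finiteT mu.
exists (fun k => @uncons_row R n @^-1` (F k `*` G k)).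
  apply/esym; rewrite -preimage_bigcup -subTset => x _ /=.
  have [i _ Fi] : (\bigcup_i F i) (x ord0 ord0) by rewrite -TF.
  have [j _ Gj] : (\bigcup_i G i) (\row_j x ord0 (lift ord0 j)) by rewrite -TG.
  exists (maxn i j) => //; split => /=.
    by move: Fi; exact/subsetPset/ndF/leq_maxl.
  by move: Gj; exact/subsetPset/ndG/leq_maxr.
move=> k; have [mF Fk] := Foo k; have [mG Gk] := Goo k; split.
  rewrite -[X in measurable X]setTI; apply: measurable_uncons_row => //.
  exact: measurableX.
rewrite /borel_lebesgueS /pushforward -comp_preimage.
rewrite (_ : _ \o _ = id) ?preimage_id//.
  by rewrite product_measure1E// lte_mul_pinfty// ge0_fin_numE.
by apply/funext => p /=; rewrite cons_rowK.
Qed.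

HB.instance Definition _ := Measure_isSigmaFinite.Build _ _ _ borel_lebesgueS
  borel_lebesgueS_sigma_finite.

End borel_lebesgue_step.

(* Lebesgue measure on the Borel sets of R^n, as an iterated product. *)
Fixpoint borel_lebesgue {R : realType} n :
    {sigma_finite_measure set 'rV[R]_n -> \bar R} :=
  match n with
  | 0%N => \d_(0 : 'rV[R]_0)
  | n'.+1 => borel_lebesgueS (borel_lebesgue n')
  end.

(* The Lebesgue sigma-algebra of R^n, i.e. the Caratheodory sigma-algebra of the
   outer measure induced by [borel_lebesgue], and the (complete) Lebesgue measure
   on it. *)
Definition lebesgueType (R : realType) (n : nat) :=
  caratheodory_type ((@borel_lebesgue R n)^*)%mu.

HB.instance Definition _ (R : realType) (n : nat) :=
  Measurable.on (lebesgueType R n).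

Definition lebesgue_rV {R : realType} {n : nat} :
    {measure set (lebesgueType R n) -> \bar R} :=
  @completed_measure_extension _ _ _ (@borel_lebesgue R n).

Lemma measurable_box {R : realType} n (I : 'I_n -> set R) :
  (forall i, measurable (I i)) ->
  measurable [set x : 'rV[R]_n | forall i, I i (x ord0 i)].
Proof.
move=> mI.
rewrite (_ : [set _ | _] =
    \big[setI/setT]_(i < n) ((fun x : 'rV[R]_n => x ord0 i) @^-1` I i)).
  apply: big_ind => //; first exact: measurableI.
  by move=> i _; rewrite -[X in measurable X]setTI; exact: measurable_coord.
by rewrite -bigcap_seq; apply/seteqP; split => x /= Ix i; [move=> _|];
  apply: Ix; rewrite /= mem_index_enum.
Qed.

Lemma borel_lebesgue_box {R : realType} n (I : 'I_n -> set R) :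
  (forall i, measurable (I i)) ->
  borel_lebesgue n [set x : 'rV[R]_n | forall i, I i (x ord0 i)] =
  (\prod_(i < n) lebesgue_measure (I i))%E.
Proof.
elim: n I => [|n IHn] I mI.
  rewrite big_ord0 /= diracE mem_set//= => -[].
  by [].
have mI' i : measurable (I (lift ord0 i)) by [].
rewrite big_ord_recl -IHn//= -product_measure1E//; last exact: (measurable_box mI').
congr (product_measure1 _ _ _); apply/seteqP; split => -[x y]/= Ixy.
  split => [|i]; first by have := Ixy ord0; rewrite cons_row0.
  by have := Ixy (lift ord0 i); rewrite cons_rowS.
move=> i; case: (unliftP ord0 i) => [j ->|->].
- by rewrite cons_rowS; exact: Ixy.2.
- by rewrite cons_row0; exact: Ixy.1.
exact: mI.
Qed.

Lemma lebesgue_rV_borel {R : realType} n (A : set 'rV[R]_n) :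
  measurable A -> lebesgue_rV A = borel_lebesgue n A.
Proof.
by move=> mA; rewrite /lebesgue_rV/= /completed_measure_extension
  measurable_mu_extE.
Qed.

Lemma lebesgue_cube {R : realType} n (a : 'rV[R]_n) (l : R) : 0 < l ->
  lebesgue_rV [set x : 'rV[R]_n | forall i,
    a ord0 i <= x ord0 i <= a ord0 i + l] = (l ^+ n)%:E.
Proof.
move=> l0.
have E : [set x : 'rV[R]_n | forall i, a ord0 i <= x ord0 i <= a ord0 i + l] =
  [set x : 'rV[R]_n | forall i, `[a ord0 i, a ord0 i + l]%classic (x ord0 i)].
  by apply/seteqP; split => x /= h i; have := h i; rewrite in_itv.
have mI (i : 'I_n) : measurable `[a ord0 i, a ord0 i + l]%classic by [].
rewrite E lebesgue_rV_borel; last exact: (measurable_box mI).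
rewrite (borel_lebesgue_box mI).
under eq_bigr do
  rewrite lebesgue_measure_itv/= lte_fin ltrDl l0 -EFinB addrAC subrr add0r.
by rewrite prodEFin prodr_const card_ord.
Qed.

Section definitions.
Context {R : realType} {n : nat}.
Implicit Types (f g : 'rV[R]_n -> R[i]) (Q : set 'rV[R]_n).

Local Notation mu := (@lebesgue_rV R n).

(* Closed nondegenerate cubes with sides parallel to the axes. *)
Definition is_cube Q : Prop :=
  exists (a : 'rV[R]_n) (l : R), 0 < l /\
    Q = [set x | forall i, a ord0 i <= x ord0 i <= a ord0 i + l].

Definition centered_cube (d : R) : set 'rV[R]_n :=
  [set x | forall i, - d <= x ord0 i <= d].

Definition mfun_complex f : Prop :=
  measurable_fun [set: lebesgueType R n] (fun x => complex.Re (f x)) /\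
  measurable_fun [set: lebesgueType R n] (fun x => complex.Im (f x)).

Definition L1loc f : Prop :=
  mfun_complex f /\
  forall K : set 'rV[R]_n, compact K ->
    (\int[mu]_(x in K) (Normc.normc (f x))%:E < +oo)%E.

Definition cmean f Q : R[i] :=
  ((\int[mu]_(x in Q) complex.Re (f x)) / fine (mu Q)) +i*
  ((\int[mu]_(x in Q) complex.Im (f x)) / fine (mu Q)).

Definition BMO_norm f : \bar R :=
  ereal_sup [set ((fine (mu Q))^-1%:E *
                  \int[mu]_(x in Q) (Normc.normc (f x - cmean f Q)%R)%:E)%E
            | Q in is_cube].

Definition BMO f : Prop := L1loc f /\ (BMO_norm f < +oo)%E.

(* [Ck k u] : the iterated partial derivatives of [u] of order at most [k] exist
   and are continuous. *)
Fixpoint Ck (k : nat) (u : 'rV[R]_n -> R) : Prop :=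
  continuous u /\
  if k is k'.+1 then
    forall i : 'I_n, (forall x, derivable u x (delta_mx ord0 i)) /\
      Ck k' (fun x => 'D_(delta_mx ord0 i) u x)
  else True.

Definition smooth_complex f : Prop :=
  forall k, Ck k (fun x => complex.Re (f x)) /\ Ck k (fun x => complex.Im (f x)).

Definition Ccinfty f : Prop :=
  smooth_complex f /\ compact (closure [set x | f x != 0]).

(* Closure for the seminorm [BMO_norm]. *)
Definition CMO f : Prop :=
  BMO f /\
  forall e : R, 0 < e ->
    exists2 g, Ccinfty g & (BMO_norm (fun x => f x - g x)%R < e%:E)%E.

(* Extended-real valued, the infimum being +oo on the empty set. *)
Definition rearrangement g (t : R) : \bar R :=
  ereal_inf [set a%:E | a in
    [set a : R | 0 < a /\ (mu [set x | (a < Normc.normc (g x))%R] < t%:E)%E]].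

Definition local_mean_osc (lambda : R) f Q : \bar R :=
  ereal_inf [set rearrangement (fun x => (f x - c) * \1_Q x)
                   (lambda * fine (mu Q))
            | c in [set: R[i]]].

End definitions.

(* Main.v *)
(* For lambda < 1/2, two values from which f deviates little off a fraction
   lambda of nested cubes of comparable sizes must be close.  A Calderon-Zygmund
   stopping argument on dyadic cubes then gives the John-Stromberg inequality:
   if every cube Q has such a value for the deviation e, then the mean
   oscillations of f are O(e), so that the BMO norm can be replaced by local mean
   oscillations at the price of a slightly larger lambda.

   For the sufficiency, treat real and imaginary parts separately.  Conditions
   (1)-(3) leave only cubes of bounded size near the origin, on which |f| exceeds a
   large M on a small set only; hence f is close to its truncation at M.  The
   truncation is multiplied by the average of the indicators of N cubes with
   rapidly growing radii, which changes the local oscillations by M / N only.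
   The resulting function has compact support and small oscillation on small
   cubes, and is approximated by a smooth partition of unity carrying its nearly
   constant values on a fine grid.

   For the necessity, Chebyshev's inequality bounds the local oscillation of f - g
   for g smooth with compact support, and g is nearly constant on small cubes
   by uniform continuity, vanishes on most of a large cube, and on a far away
   one. *)
Require Import Defs.
From HB Require Import structures.
From mathcomp Require Import all_boot all_order all_algebra.
From mathcomp Require Import all_classical all_reals all_analysis.
From mathcomp Require Import measurable_realfun complex.
From mathcomp Require Import ring lra.
Set Implicit Arguments.
Unset Strict Implicit.
Unset Printing Implicit Defensive.
Import Order.TTheory GRing.Theory Num.Theory.
Import numFieldNormedType.Exports.
Local Open Scope classical_set_scope.
Local Open Scope ring_scope.
Local Open Scope complex_scope.

(** * Half-open cubes *)

Section cubes.
Context {R : realType} {n : nat}.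
Local Notation T := (lebesgueType R n).
Local Notation mu := (@lebesgue_rV R n).

(** Half-open cubes serve the sufficiency because such a cube is exactly the disjoint union of its
    dyadic children; closed cubes return only at the interface with [local_mean_osc] and [BMO_norm].
    The stopping argument must discard the points of the bad set that never fall into a dyadic cube
    half filled by it. The Lebesgue differentiation theorem would do this; here it is replaced by
    the approximation, in volume, of a measurable set by finite unions of dyadic cubes. That error
    controls an integral only if the integrand is bounded, so the mean oscillation estimate is first
    proved for bounded functions, with a constant independent of the bound, and then extended by
    truncation and monotone convergence. Boundedness also makes finite the supremum that has to be
    absorbed. Up to the final integral bounds, functions are handled through values from which they
    deviate little off a fraction of a cube: such values pass through Lipschitz maps, and
    exceptional sets simply add their fractions. The gap between [lam] and 1/2 pays for them. *)

Definition hcube (a : 'rV[R]_n) (l : R) : set T :=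
  [set x : 'rV[R]_n | forall i, a ord0 i <= x ord0 i < a ord0 i + l].

Definition child (a : 'rV[R]_n) (l : R) (e : {ffun 'I_n -> bool}) : 'rV[R]_n :=
  \row_i (a ord0 i + (l / 2) *+ e i).

Lemma borel_lebesgueW (A : set 'rV[R]_n) :
  measurable A -> measurable (A : set T).
Proof. exact: caratheodory_measurable_mu_ext. Qed.

Lemma measurable_coordL (i : 'I_n) :
  measurable_fun [set: T] (fun x : T => (x : 'rV[R]_n) ord0 i).
Proof.
move=> _ Y mY; rewrite setTI; apply: borel_lebesgueW.
by rewrite -[X in measurable X]setTI; exact: measurable_coord.
Qed.

Lemma hcubeE (a : 'rV[R]_n) (l : R) : hcube a l =
  [set x : 'rV[R]_n | forall i, `[a ord0 i, a ord0 i + l[%classic (x ord0 i)].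
Proof. by apply/seteqP; split => x /= h i; have := h i; rewrite in_itv. Qed.

Lemma measurable_hcube a l : measurable (hcube a l).
Proof.
apply: borel_lebesgueW; rewrite hcubeE.
by apply: (measurable_box (I := fun i => `[a ord0 i, a ord0 i + l[%classic)).
Qed.

Lemma mu_hcube a l : 0 < l -> mu (hcube a l) = (l ^+ n)%:E.
Proof.
move=> l0; rewrite hcubeE.
have mI (i : 'I_n) : measurable `[a ord0 i, a ord0 i + l[%classic by [].
rewrite lebesgue_rV_borel; last exact: (measurable_box mI).
rewrite (borel_lebesgue_box mI).
under eq_bigr do
  rewrite lebesgue_measure_itv/= lte_fin ltrDl l0 -EFinB addrAC subrr add0r.
by rewrite prodEFin prodr_const card_ord.
Qed.

Lemma hcubeS (a : 'rV[R]_n) l (b : 'rV[R]_n) k : (forall i, b ord0 i <= a ord0 i) ->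
  (forall i, a ord0 i + l <= b ord0 i + k) -> hcube a l `<=` hcube b k.
Proof. by move=> h1 h2 x /= hx i; have := hx i; have := h1 i; have := h2 i; lra. Qed.

Lemma child_itv (a : 'rV[R]_n) l e i : 0 < l ->
  a ord0 i <= child a l e ord0 i /\ child a l e ord0 i + l / 2 <= a ord0 i + l.
Proof. by move=> l0; rewrite mxE; case: (e i); rewrite ?mulr1n ?mulr0n; lra. Qed.

Lemma sub_child a l e : 0 < l -> hcube (child a l e) (l / 2) `<=` hcube a l.
Proof. by move=> l0; apply: hcubeS => i; have [] := child_itv a e i l0. Qed.

Lemma hcube_children a l : 0 < l ->
  hcube a l = \big[setU/set0]_(e : {ffun 'I_n -> bool}) hcube (child a l e) (l / 2).
Proof.
move=> l0; apply/seteqP; split => x; rewrite -bigcup_seq /=.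
  move=> hx; exists [ffun i => a ord0 i + l / 2 <= x ord0 i].
    by rewrite /= mem_index_enum.
  move=> i; rewrite mxE ffunE; have := hx i.
  by case: (lerP (a ord0 i + l / 2) (x ord0 i)); rewrite ?mulr1n ?mulr0n; lra.
by move=> [e _]; exact: sub_child.
Qed.

Lemma trivIset_children a l : 0 < l ->
  trivIset setT (fun e : {ffun 'I_n -> bool} => hcube (child a l e) (l / 2)).
Proof.
move=> l0 e f _ _ [x [he hf]]; apply/ffunP => i.
by have := he i; have := hf i; rewrite !mxE; case: (e i); case: (f i);
  rewrite ?mulr1n ?mulr0n //; lra.
Qed.

(** This is the only additivity that a recursion over dyadic children needs; the extra set [A]
    allows its use on the part of a cube lying in a bad set. *)
Definition additive_cube (m : set T -> R) := forall (A : set T) a l,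
  measurable A -> 0 < l -> m (A `&` hcube a l) =
  \sum_(e : {ffun 'I_n -> bool}) m (A `&` hcube (child a l e) (l / 2)).

Definition vol (A : set T) : R := fine (mu A).

Definition Int (phi : T -> R) (A : set T) : R :=
  fine (\int[mu]_(x in A) (phi x)%:E).

Lemma mu_hcube_fin (A : set T) (a : 'rV[R]_n) (l : R) : measurable A -> 0 < l ->
  mu (A `&` hcube a l) \is a fin_num.
Proof.
move=> mA l0; rewrite ge0_fin_numE//.
have : (mu (A `&` hcube a l) <= mu (hcube a l))%E.
  by apply: measureIr => //; exact: measurable_hcube.
by move=> /le_lt_trans; apply; rewrite mu_hcube// ltry.
Qed.

Lemma vol_hcube a l : 0 < l -> vol (hcube a l) = l ^+ n.
Proof. by move=> l0; rewrite /vol mu_hcube. Qed.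

Lemma volE (A : set T) (a : 'rV[R]_n) (l : R) :
  measurable A -> A `<=` hcube a l -> 0 < l ->
  mu A = (vol A)%:E.
Proof.
move=> mA AS l0; rewrite /vol fineK//.
by have := mu_hcube_fin a mA l0; rewrite (setIidl AS).
Qed.

Lemma vol_ge0 A : 0 <= vol A.
Proof. by rewrite /vol fine_ge0. Qed.

Lemma vol_le (A B : set T) (a : 'rV[R]_n) (l : R) :
  measurable A -> measurable B -> 0 < l ->
  B `<=` hcube a l -> A `<=` B -> vol A <= vol B.
Proof.
move=> mA mB l0 Bl AB; rewrite -lee_fin -(volE mA (subset_trans AB Bl) l0).
by rewrite -(volE mB Bl l0); apply: le_measure; rewrite ?inE.
Qed.

Lemma volU (A B : set T) (a : 'rV[R]_n) (l : R) : measurable A -> measurable B -> 0 < l ->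
  A `<=` hcube a l -> B `<=` hcube a l -> vol (A `|` B) <= vol A + vol B.
Proof.
move=> mA mB l0 Al Bl; have Ul : A `|` B `<=` hcube a l by move=> x []; auto.
rewrite -lee_fin EFinD -(volE mA Al l0) -(volE mB Bl l0).
rewrite -(volE (measurableU _ _ mA mB) Ul l0); exact: measureU2.
Qed.

Lemma volD (A B : set T) (a : 'rV[R]_n) (l : R) : measurable A -> measurable B -> 0 < l ->
  B `<=` hcube a l -> A `<=` B -> vol (B `\` A) = vol B - vol A.
Proof.
move=> mA mB l0 Bl AB; have Al := subset_trans AB Bl.
have Dl : B `\` A `<=` hcube a l by move=> x [] /Bl.
have mD := measurableD mB mA.
have : mu B = (mu A + mu (B `\` A))%E.
  rewrite -measureU ?setDUK// setDE setIC -setIA setICl setI0 //.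
rewrite (volE mB Bl l0) (volE mA Al l0) (volE mD Dl l0) -EFinD => -[->].
by rewrite addrAC subrr add0r.
Qed.

Lemma Int_hcube_fin (phi : T -> R) (M : R) (A : set T) (a : 'rV[R]_n) (l : R) :
  measurable A -> 0 < l ->
  A `<=` hcube a l -> measurable_fun setT phi -> (forall x, 0 <= phi x <= M) ->
  (\int[mu]_(x in A) (phi x)%:E <= (M * vol A)%:E)%E.
Proof.
move=> mA l0 Al mphi pM.
have mE : measurable_fun A (EFin \o phi).
  by apply/measurable_EFinP; exact: measurable_funTS.
rewrite EFinM -(volE mA Al l0) -integral_cst//; apply: ge0_le_integral => //.
- by move=> x _; rewrite lee_fin; case/andP: (pM x).
- by move=> x _; rewrite lee_fin; case/andP: (pM x).
Qed.

Lemma IntE (phi : T -> R) (M : R) (A : set T) (a : 'rV[R]_n) (l : R) :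
  measurable A -> 0 < l ->
  A `<=` hcube a l -> measurable_fun setT phi -> (forall x, 0 <= phi x <= M) ->
  (\int[mu]_(x in A) (phi x)%:E)%E = (Int phi A)%:E.
Proof.
move=> mA l0 Al mphi pM; rewrite /Int fineK// ge0_fin_numE; last first.
  by apply: integral_ge0 => x _; rewrite lee_fin; case/andP: (pM x).
by rewrite (le_lt_trans (Int_hcube_fin mA l0 Al mphi pM))// ltry.
Qed.

Lemma Int_le_vol (phi : T -> R) (M : R) (A : set T) (a : 'rV[R]_n) (l : R) :
  measurable A -> 0 < l ->
  A `<=` hcube a l -> measurable_fun setT phi -> (forall x, 0 <= phi x <= M) ->
  Int phi A <= M * vol A.
Proof.
move=> mA l0 Al mphi pM; rewrite -lee_fin -(IntE mA l0 Al mphi pM).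
exact: Int_hcube_fin mA l0 Al mphi pM.
Qed.

Lemma Int_le (phi : T -> R) (M : R) (A B : set T) (a : 'rV[R]_n) (l : R) :
  measurable A -> measurable B ->
  0 < l -> B `<=` hcube a l -> A `<=` B ->
  measurable_fun setT phi -> (forall x, 0 <= phi x <= M) ->
  Int phi A <= Int phi B.
Proof.
move=> mA mB l0 Bl AB mphi pM.
rewrite -lee_fin -(IntE mA l0 (subset_trans AB Bl) mphi pM).
rewrite -(IntE mB l0 Bl mphi pM); apply: (@ge0_subset_integral _ _ _ mu A B mA mB) AB.
  by apply/measurable_EFinP; exact: measurable_funTS.
by move=> x _; rewrite lee_fin; case/andP: (pM x).
Qed.

Lemma Int_additive (phi : T -> R) (M : R) :
  measurable_fun setT phi -> (forall x, 0 <= phi x <= M) ->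
  additive_cube (Int phi).
Proof.
move=> mphi pM A a l mA l0.
have l20 : 0 < l / 2 by lra.
have mI a' l' : measurable (A `&` hcube a' l').
  by apply: measurableI => //; exact: measurable_hcube.
have phi0 x : (0 <= (phi x)%:E)%E by rewrite lee_fin; case/andP: (pM x).
have E : A `&` hcube a l = \big[setU/set0]_(e <- index_enum {ffun 'I_n -> bool})
    (A `&` hcube (child a l e) (l / 2)).
  by rewrite (hcube_children a l0) big_distrr.
apply: EFin_inj; rewrite -sumEFin -(IntE (mI a l) l0 (@subIsetr _ _ _) mphi pM).
rewrite E ge0_integral_bigsetU; first last.
- by move=> x _; exact: phi0.
- by apply/measurable_EFinP; exact: measurable_funTS.
- move=> e f _ _ [x [[_ xe] [_ xf]]].
  by apply: (trivIset_children (a := a) l0 (i := e) (j := f)) => //; exists x.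
- exact: index_enum_uniq.
- by move=> e; exact: mI.
apply: eq_bigr => e _.
exact: (IntE (mI _ _) l20 (@subIsetr _ _ _) mphi pM).
Qed.

Lemma vol_Int A : measurable A -> vol A = Int (cst 1) A.
Proof.
by move=> mA; have := integral_cst mu mA 1%E; rewrite mul1e /vol /Int => <-.
Qed.

Lemma vol_additive : additive_cube vol.
Proof.
move=> A a l mA l0.
have mI a' l' : measurable (A `&` hcube a' l').
  by apply: measurableI => //; exact: measurable_hcube.
rewrite vol_Int// (@Int_additive (cst 1) 1)//; last by move=> x /=; lra.
by apply: eq_bigr => e _; rewrite vol_Int.
Qed.

End cubes.

(** * Approximation of measurable sets by dyadic cubes *)

Section dyadic_approximation.
Context {R : realType} {n : nat}.
Local Notation T := (lebesgueType R n).
Local Notation mu := (@lebesgue_rV R n).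

(** Inside the cube, [F] is a union of descendants of generation [N]. Nothing is asked of [F]
    outside, and the base case is symmetric in [F] and its complement. *)
Fixpoint dyadic_union (N : nat) (F : set T) (a : 'rV[R]_n) (l : R) : Prop :=
  if N is N'.+1 then forall e, dyadic_union N' F (child a l e) (l / 2)
  else hcube a l `<=` F \/ hcube a l `<=` ~` F.

Lemma dyadic_unionS N (F : set T) (a : 'rV[R]_n) (l : R) : 0 < l ->
  dyadic_union N F a l ->
  dyadic_union N.+1 F a l.
Proof.
elim: N a l => [|N IHN] a l l0 /=; last first.
  by move=> H e; apply: (IHN _ _ _ (H e)); lra.
by move=> [H|H] e; [left|right]; apply: subset_trans H; exact: sub_child.
Qed.

Lemma dyadic_union_le N M (F : set T) (a : 'rV[R]_n) (l : R) : (N <= M)%N -> 0 < l ->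
  dyadic_union N F a l -> dyadic_union M F a l.
Proof.
move=> NM l0 H; rewrite -(subnK NM).
by elim: (M - N)%N => [//|k IHk]; rewrite addSn; exact: dyadic_unionS.
Qed.

Lemma dyadic_unionC N F a l : dyadic_union N F a l -> dyadic_union N (~` F) a l.
Proof.
elim: N a l => [|N IHN] a l /=; last by move=> H e; exact/IHN/H.
by rewrite setCK => -[H|H]; [right|left].
Qed.

Lemma dyadic_unionU N F G a l : dyadic_union N F a l -> dyadic_union N G a l ->
  dyadic_union N (F `|` G) a l.
Proof.
elim: N a l => [|N IHN] a l /=; last first.
  by move=> H K e; exact: IHN (H e) (K e).
move=> [H|H]; first by left => x /H; left.
move=> [K|K]; first by left => x /K; right.
by right => x xl [/(H x xl)|/(K x xl)].
Qed.

(** The threshold lies on the grid of generation [N]. Passing to an upper child moves the corner by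
    [l / 2], which is [2 ^+ N] meshes of the finer grid, whence the new index
    [k - (e i)%:Z * 2 ^+ N]. *)
Lemma dyadic_union_halfspace N (i : 'I_n) (k : int) (a : 'rV[R]_n) (l : R) : 0 < l ->
  dyadic_union N [set x : 'rV[R]_n | x ord0 i < a ord0 i + l * k%:~R / 2 ^+ N]
    a l.
Proof.
elim: N a l k => [|N IHN] a l k l0 /=.
  rewrite expr0 divr1; have [k0|k0] := lerP k 0.
    right=> x /(_ i) h /=.
    have : l * k%:~R <= 0 by rewrite pmulr_rle0// lerz0.
    by move: h; lra.
  left=> x /(_ i) h /=.
  have : l <= l * k%:~R by rewrite ler_peMr ?(ltW l0)// ler1z.
  by move: h; lra.
move=> e; have l20 : 0 < l / 2 by lra.
have := IHN (child a l e) (l / 2) (k - (e i)%:Z * 2 ^+ N) l20.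
congr (dyadic_union _ _ _ _); apply/funext => x; congr (is_true (_ < _)).
rewrite mxE rmorphB/= rmorphM/= rmorphXn/= exprS -mulr_natr.
have : (2 ^+ N : R) != 0 by rewrite expf_neq0.
case: (e i) => /= h; field; exact: h.
Qed.

(** Good sets principle: this class is a sigma-algebra containing the half-spaces, hence all Borel
    sets. The error is measured in one fixed cube, so that all volumes are finite. *)
Definition approximable (a : 'rV[R]_n) (l : R) (E : set T) : Prop :=
  measurable E /\ forall eta : R, 0 < eta -> exists N F,
    [/\ measurable F, dyadic_union N F a l &
        vol (hcube a l `&` (E `+` F)) <= eta].

Lemma mu_box (b w : 'rV[R]_n) : (forall i, 0 < w ord0 i) ->
  measurable ([set x : 'rV[R]_n | forall i,
    b ord0 i <= x ord0 i < b ord0 i + w ord0 i] : set T) /\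
  mu [set x : 'rV[R]_n | forall i, b ord0 i <= x ord0 i < b ord0 i + w ord0 i]
  = (\prod_i w ord0 i)%:E.
Proof.
move=> w0.
have E : [set x : 'rV[R]_n | forall i,
    b ord0 i <= x ord0 i < b ord0 i + w ord0 i] = [set x : 'rV[R]_n |
    forall i, `[b ord0 i, b ord0 i + w ord0 i[%classic (x ord0 i)].
  by apply/seteqP; split => x /= h i; have := h i; rewrite in_itv.
have mI (i : 'I_n) : measurable `[b ord0 i, b ord0 i + w ord0 i[%classic by [].
have mB := measurable_box mI.
rewrite E; split; first exact: borel_lebesgueW.
rewrite lebesgue_rV_borel// (borel_lebesgue_box mI) -prodEFin.
apply: eq_bigr => i _.
by rewrite lebesgue_measure_itv/= lte_fin ltrDl w0 -EFinB addrAC subrr add0r.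
Qed.

Lemma exists_half (c eta : R) : 0 < eta -> exists N, c / 2 ^+ N <= eta.
Proof.
move=> e0; exists (Num.bound `|c / eta|).
rewrite ler_pdivrMr ?exprn_gt0// mulrC -ler_pdivrMr//.
apply: (le_trans (ler_norm _)); apply: ltW.
apply: (lt_le_trans (archi_boundP (normr_ge0 _))).
by rewrite -natrX ler_nat ltnW// ltn_expl.
Qed.

Lemma approximable0 a l : approximable a l set0.
Proof.
split=> // eta e0; exists 0%N, set0; split => //; first by right => x _ [].
by rewrite setYK setI0 /vol measure0/= ltW.
Qed.

Lemma approximableC a l E : approximable a l E -> approximable a l (~` E).
Proof.
move=> [mE H]; split; first exact: measurableC.
move=> eta /H [N [F [mF NF le]]]; exists N, (~` F); split => //.
- exact: measurableC.
- exact: dyadic_unionC.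
- have -> // : ~` E `+` ~` F = E `+` F.
  by rewrite /setY !setDE !setCK setUC; congr setU; exact: setIC.
Qed.

Lemma measurable_setY (E F : set T) : measurable E -> measurable F ->
  measurable (E `+` F).
Proof. by move=> mE mF; apply: measurableU; exact: measurableD. Qed.

Lemma approximableU a l E1 E2 : 0 < l -> approximable a l E1 ->
  approximable a l E2 -> approximable a l (E1 `|` E2).
Proof.
move=> l0 [mE1 H1] [mE2 H2]; split; first exact: measurableU.
move=> eta e0; have e20 : 0 < eta / 2 by lra.
have [N1 [F1 [mF1 NF1 le1]]] := H1 _ e20.
have [N2 [F2 [mF2 NF2 le2]]] := H2 _ e20.
exists (maxn N1 N2), (F1 `|` F2); split.
- exact: measurableU.
- apply: dyadic_unionU.
  + by apply: dyadic_union_le NF1 => //; exact: leq_maxl.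
  + by apply: dyadic_union_le NF2 => //; exact: leq_maxr.
- have mQ := measurable_hcube a l.
  have m1 := measurableI _ _ mQ (measurable_setY mE1 mF1).
  have m2 := measurableI _ _ mQ (measurable_setY mE2 mF2).
  have mU := measurableI _ _ mQ
    (measurable_setY (measurableU _ _ mE1 mE2) (measurableU _ _ mF1 mF2)).
  have := volU m1 m2 l0 (@subIsetl _ _ _) (@subIsetl _ _ _).
  have : vol (hcube a l `&` (E1 `|` E2 `+` (F1 `|` F2))) <=
      vol (hcube a l `&` (E1 `+` F1) `|` hcube a l `&` (E2 `+` F2)).
    apply: (vol_le (a := a) (l := l)) => //; first exact: measurableU.
      by rewrite -setIUr; exact: subIsetl.
    move=> x [xl] [[[h|h] /not_orP[k1 k2]]|[[h|h] /not_orP[k1 k2]]].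
    + by left; split => //; left.
    + by right; split => //; left.
    + by left; split => //; right.
    + by right; split => //; right.
  lra.
Qed.

(** A partial union [V m] misses only [G m] inside the cube, and the volume of [G m] tends to 0 by
    continuity from above. One half of [eta] goes to this tail, the other to the approximation of
    [V m]. *)
Lemma approximable_bigcup a l (E : (set T)^nat) : 0 < l ->
  (forall k, approximable a l (E k)) -> approximable a l (\bigcup_k E k).
Proof.
move=> l0 HE.
have mE k : measurable (E k) by case: (HE k).
split; first exact: bigcupT_measurable.
move=> eta e0; have e20 : 0 < eta / 2 by lra.
pose U := \bigcup_k E k; pose V m := \big[setU/set0]_(k < m) E k.
have mU : measurable U by exact: bigcupT_measurable.
have mV m : measurable (V m) by exact: bigsetU_measurable.
have AV m : approximable a l (V m).
  by apply: big_ind => [|A B|k _]; [exact: approximable0|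
    exact: approximableU|exact: HE].
pose G m := hcube a l `&` (U `\` V m).
have mQ := measurable_hcube a l.
have mG m : measurable (G m) by exact/measurableI/measurableD.
have ndV : nondecreasing_seq V.
  by move=> i j ij; apply/subsetPset; rewrite /V -!bigcup_mkord => x [k /= ki Ek];
    exists k => //=; exact: leq_trans ij.
have niG : nonincreasing_seq G.
  move=> i j ij; apply/subsetPset => x [xl [Ux Vx]]; split => //; split => //.
  by apply: contra_not Vx; move: x {xl Ux}; exact/subsetPset/ndV.
have G0 : \bigcap_m G m = set0.
  rewrite -subset0 => x Gx; have [_ [[k _ Ek] _]] := Gx 0%N I.
  have [_ [_ +]] := Gx k.+1 I; apply.
  by rewrite /V -bigcup_mkord; exists k => /=.
have : mu \o G @ \oo --> mu (\bigcap_m G m).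
  apply: nonincreasing_cvg_mu => //.
    rewrite (volE (mG _) (@subIsetl _ _ _) l0); exact: ltry.
  by rewrite G0.
rewrite G0 measure0 => cG.
have [m Gm] : exists m, vol (G m) < eta / 2.
  have /fine_cvgP[_ /cvgr_lt/(_ _ e20)[m _ /(_ m (leqnn m)) Gm]] := cG.
  by exists m.
have [_ /(_ _ e20)[N [F [mF NF le]]]] := AV m.
exists N, F; split => //.
have mVF := measurableI _ _ mQ (measurable_setY (mV m) mF).
have := volU (mG m) mVF l0 (@subIsetl _ _ _) (@subIsetl _ _ _).
have : vol (hcube a l `&` (U `+` F)) <=
    vol (G m `|` hcube a l `&` (V m `+` F)).
  apply: (vol_le (a := a) (l := l)) => //.
  - by apply: measurableI => //; exact: measurable_setY.
  - exact: measurableU.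
  - by rewrite -setIUr; exact: subIsetl.
  move=> x [xl] [[Ux Fx]|[Fx Ux]].
    by have [Vx|Vx] := pselect (V m x); [right; split => //; left|left].
  right; split => //; right; split => //; apply: contra_not Ux.
  by rewrite /V -bigcup_mkord => -[k _ Ek]; exists k.
rewrite -/U; move: Gm le; lra.
Qed.

Lemma sigma_algebra_approximable a l : 0 < l ->
  sigma_algebra setT (approximable a l).
Proof.
move=> l0; split; first exact: approximable0.
- by move=> E HE; rewrite setTD; exact: approximableC.
- by move=> E HE; exact: approximable_bigcup.
Qed.

(** Rounding [t] down to the dyadic grid changes the half-space, inside the cube, within a slab of
    thickness [w = l / 2 ^+ N], whose volume is [l ^+ n / 2 ^+ N]. *)
Lemma approximable_halfspace (a : 'rV[R]_n) (l : R) (i : 'I_n) (t : R) : 0 < l ->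
  approximable a l [set x : 'rV[R]_n | x ord0 i < t].
Proof.
move=> l0.
have mH s : measurable ([set x : 'rV[R]_n | x ord0 i < s] : set T).
  have := @measurable_coordL R n i measurableT `]-oo, s[%classic (measurable_itv _).
  by rewrite setTI; congr measurable; apply/seteqP; split => x; rewrite /= in_itv.
split => // eta e0.
have [N leN] := exists_half (l ^+ n) e0.
pose w := l / 2 ^+ N; have w0 : 0 < w by rewrite divr_gt0// exprn_gt0.
pose k := Num.floor ((t - a ord0 i) / w).
pose s := a ord0 i + l * k%:~R / 2 ^+ N.
have sE : s = a ord0 i + w * k%:~R by rewrite /s /w; ring.
have st : s <= t.
  have : w * k%:~R <= t - a ord0 i by rewrite mulrC -ler_pdivlMr// floor_le.
  by rewrite sE; lra.
have ts : t < s + w.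
  have : t - a ord0 i < w * (k + 1)%:~R by rewrite mulrC -ltr_pdivrMr// floorD1_gt.
  by rewrite sE rmorphD/= mulrDr mulr1; lra.
exists N, [set x : 'rV[R]_n | x ord0 i < s]; split => //.
  exact: dyadic_union_halfspace.
pose b : 'rV[R]_n := \row_j (if j == i then s else a ord0 j).
pose v : 'rV[R]_n := \row_j (if j == i then w else l).
have v0 j : 0 < v ord0 j by rewrite mxE; case: ifP.
have [mB muB] := mu_box b v0.
apply: le_trans leN; rewrite /vol -lee_fin fineK; last first.
  rewrite setIC; apply: mu_hcube_fin => //; exact: measurable_setY.
have -> : l ^+ n / 2 ^+ N = \prod_j v ord0 j.
  rewrite (bigD1 i)//= mxE eqxx (eq_bigr (fun=> l)) => [|j /negbTE ji]; last first.
    by rewrite mxE ji.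
  rewrite prodr_const cardC1 card_ord /w.
  by rewrite -[in LHS](ltn_predK (ltn_ord i)) exprS; ring.
rewrite -muB; apply: le_measure; rewrite ?inE//.
  by apply: measurableI; [exact: measurable_hcube|exact: measurable_setY].
move=> x [xl H] j; rewrite !mxE; case: eqP => [->|_]; last exact: xl.
by move: H => /= [[h1 h2]|[h1 h2]]; move/negP: h2; rewrite -leNgt => h2; lra.
Qed.

Lemma borel_approximable (a : 'rV[R]_n) (l : R) (E : set 'rV[R]_n) : 0 < l ->
  measurable E -> approximable a l E.
Proof.
move=> l0; apply: smallest_sub; first exact: sigma_algebra_approximable.
rewrite -bigcup_seq => A [i _ [Y mY <-]].
move: mY; rewrite [X in X Y -> _]RGenInftyO.measurableE => mY.
pose f (x : 'rV[R]_n) := x ord0 i.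
suff : image_set_system setT f (approximable a l) Y by [].
move: Y mY; apply: smallest_sub.
  exact: (sigma_algebra_image _ (sigma_algebra_approximable a l0)).
move=> _ [t ->]; rewrite /image_set_system /= setTI.
have := approximable_halfspace a i t l0; congr approximable.
Qed.

(** The outer measure provides a countable Borel cover of the part of [E] in the cube with excess at
    most [eta / 2]; the union [B] of the cover is Borel and can be approximated in place of [E]. *)
Lemma measurable_approximable (a : 'rV[R]_n) (l : R) (E : set T) : 0 < l ->
  measurable E -> approximable a l E.
Proof.
move=> l0 mE; split => // eta e0; have e20 : 0 < eta / 2 by lra.
have mQ := measurable_hcube a l.
have mE1 : measurable (hcube a l `&` E) by exact: measurableI.
have fE1 := volE mE1 (@subIsetl _ _ _) l0.
have [F [mF EF] ltF] : exists2 F, @measurable_cover _ 'rV[R]_n (hcube a l `&` E) F &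
    (\sum_(k <oo) borel_lebesgue n (F k) <
     (vol (hcube a l `&` E) + eta / 2)%:E)%E.
  have fin : ereal_inf [set (\sum_(k <oo) borel_lebesgue n (F k))%E |
      F in @measurable_cover _ 'rV[R]_n (hcube a l `&` E)] \is a fin_num.
    by have : mu (hcube a l `&` E) \is a fin_num by rewrite fE1.
  have [_ [F cF <-] lt] := lb_ereal_inf_adherent e20 fin.
  exists F => //; rewrite EFinD -fE1; exact: lt.
pose B := \bigcup_k F k.
have mB : measurable (B : set 'rV[R]_n) by exact: bigcupT_measurable.
have ltB : (mu B < (vol (hcube a l `&` E) + eta / 2)%:E)%E.
  rewrite lebesgue_rV_borel//; apply: le_lt_trans ltF.
  exact: measure_sigma_subadditive.
have [mB' /(_ _ e20)[N [G [mG NG le]]]] := borel_approximable a l0 mB.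
exists N, G; split => //.
pose D := hcube a l `&` (B `\` E).
have mD : measurable D by exact/measurableI/measurableD.
have mBG := measurableI _ _ mQ (measurable_setY mB' mG).
have volD : vol D <= eta / 2.
  have EDB : (mu (hcube a l `&` E) + mu D <= mu B)%E.
    rewrite -measureU//; last first.
      by rewrite -subset0 => x [[_ Ex] [_ [_]]]; apply.
    apply: le_measure; rewrite ?inE//; first exact: measurableU.
    by move=> x [/EF//|[_ [Bx _]]].
  have := le_lt_trans EDB ltB.
  by rewrite fE1 (volE mD (@subIsetl _ _ _) l0) -EFinD lte_fin; lra.
have := volU mD mBG l0 (@subIsetl _ _ _) (@subIsetl _ _ _).
have : vol (hcube a l `&` (E `+` G)) <= vol (D `|` hcube a l `&` (B `+` G)).
  apply: (vol_le (a := a) (l := l)) => //.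
  - by apply: measurableI => //; exact: measurable_setY.
  - exact: measurableU.
  - by rewrite -setIUr; exact: subIsetl.
  move=> x [xl] [[Ex Gx]|[Gx Ex]].
    by right; split => //; left; split => //; apply: EF.
  by have [Bx|Bx] := pselect (B x); [left|right; split => //; right].
lra.
Qed.

End dyadic_approximation.

(** * The John-Stromberg inequality *)

Section stopping.
Context {R : realType} {n : nat}.
Local Notation T := (lebesgueType R n).
Local Notation mu := (@lebesgue_rV R n).
Implicit Types (a : 'rV[R]_n) (l : R) (E : set T).

(* Error term of the stopping-time argument on dyadic subcubes: it vanishes as
   [N] grows because [E] is nearly a union of dyadic cubes. *)
Fixpoint light_part (m : set T -> R) E N a l : R :=
  if N is N'.+1 then \sum_e light_part m E N' (child a l e) (l / 2)
  else if vol (E `&` hcube a l) <= l ^+ n / 2 then m (E `&` hcube a l) else 0.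

Lemma light_part_ge0 m E N a l : (forall A, 0 <= m A) ->
  0 <= light_part m E N a l.
Proof.
move=> m0; elim: N a l => [|N IHN] a l /=; first by case: ifP.
by apply: sumr_ge0.
Qed.

Lemma light_part_le m E (M : R) N a l :
  (forall b k, 0 < k -> m (E `&` hcube b k) <= M * vol (E `&` hcube b k)) ->
  0 < l -> light_part m E N a l <= M * light_part vol E N a l.
Proof.
move=> mM; elim: N a l => [|N IHN] a l l0 /=.
  by case: ifP; rewrite ?mulr0// => _; exact: mM.
by rewrite mulr_sumr; apply: ler_sum => e _; apply: IHN; lra.
Qed.

(** In a light cube of the last generation, either [F] is absent and [E] lies in the symmetric
    difference, or [F] fills the cube and the complement of [E], at least half of the cube, lies in
    it and outweighs [E]. *)
Lemma light_part_dyadic_union E (F : set T) N a l :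
  measurable E -> measurable F -> 0 < l -> dyadic_union N F a l ->
  light_part vol E N a l <= vol (hcube a l `&` (E `+` F)).
Proof.
move=> mE mF; elim: N a l => [|N IHN] a l l0 /=; last first.
  move=> H; rewrite setIC (vol_additive _ (measurable_setY mE mF) l0).
  by apply: ler_sum => e _; rewrite setIC; apply: IHN => //; lra.
have mQ := measurable_hcube a l.
have mY := measurableI _ _ mQ (measurable_setY mE mF).
case: ifP => [le H|_ _]; last exact: vol_ge0.
case: H => H; last first.
  apply: (vol_le (a := a) (l := l)) => //; first exact: measurableI.
  by move=> x [Ex xl]; split => //; left; split => //; exact: H.
have : vol (hcube a l `\` (E `&` hcube a l)) <= vol (hcube a l `&` (E `+` F)).
  apply: (vol_le (a := a) (l := l)) => //.
    by apply: measurableD => //; exact: measurableI.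
  by move=> x [xl Ex]; split => //; right; split; [exact: H|move=> ?; apply: Ex].
rewrite (volD (a := a) _ mQ l0)//; last exact: measurableI.
by rewrite vol_hcube//; move: le; lra.
Qed.

(** Descend as long as [E] fills at most half of the cube. At the first heavier child, whose parent
    is light, [m] of the whole child is at most [K] times its volume, and this volume is less than
    twice that of [E] in it. Cubes still light after [N] generations go into [light_part]. *)
Lemma stopping_le m E (K : R) N a l : additive_cube m -> (forall A, 0 <= m A) ->
  measurable E -> 0 <= K ->
  (forall b k, 0 < k -> m (E `&` hcube b k) <= m (hcube b k)) ->
  (forall b k, 0 < k -> vol (E `&` hcube b k) <= k ^+ n / 2 ->
    forall e, m (hcube (child b k e) (k / 2)) <= K * (k / 2) ^+ n) ->
  0 < l -> vol (E `&` hcube a l) <= l ^+ n / 2 ->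
  m (E `&` hcube a l) <= 2 * K * vol (E `&` hcube a l) + light_part m E N a l.
Proof.
move=> addm m0 mE K0 mS HK; elim: N a l => [|N IHN] a l l0 le /=.
  by rewrite le lerDr mulr_ge0 ?vol_ge0// mulr_ge0.
have l20 : 0 < l / 2 by lra.
rewrite addm// [in leRHS](vol_additive _ mE l0) mulr_sumr -big_split/=.
apply: ler_sum => e _.
have [leQ|ltQ] := lerP (vol (E `&` hcube (child a l e) (l / 2))) ((l / 2) ^+ n / 2).
  exact: IHN.
apply: (le_trans (mS _ _ l20)); apply: (le_trans (HK _ _ l0 le e)).
have := light_part_ge0 E N (child a l e) (l / 2) m0.
have : K * (l / 2) ^+ n <= 2 * K * vol (E `&` hcube (child a l e) (l / 2)).
  by rewrite mulrAC [leRHS]mulrC ler_wpM2l//; lra.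
by lra.
Qed.

Lemma stopping m E (K M : R) a l : additive_cube m -> (forall A, 0 <= m A) ->
  measurable E -> 0 <= K -> 0 <= M ->
  (forall b k, 0 < k -> m (E `&` hcube b k) <= m (hcube b k)) ->
  (forall b k, 0 < k -> m (E `&` hcube b k) <= M * vol (E `&` hcube b k)) ->
  (forall b k, 0 < k -> vol (E `&` hcube b k) <= k ^+ n / 2 ->
    forall e, m (hcube (child b k e) (k / 2)) <= K * (k / 2) ^+ n) ->
  0 < l -> vol (E `&` hcube a l) <= l ^+ n / 2 ->
  m (E `&` hcube a l) <= 2 * K * vol (E `&` hcube a l).
Proof.
move=> addm m0 mE K0 M0 mS mM HK l0 le; apply/ler_addgt0Pr => eta e0.
(* The divisor is [M + 1] because [M] may vanish; the light part will be at most
   [M * (eta / (M + 1)) <= eta]. *)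
have eM : 0 < eta / (M + 1) by rewrite divr_gt0//; lra.
have [_ /(_ _ eM)[N [F [mF NF leF]]]] := measurable_approximable a l0 mE.
apply: (le_trans (stopping_le N addm m0 mE K0 mS HK l0 le)); rewrite lerD2l.
apply: (le_trans (light_part_le N a mM l0)).
have := light_part_dyadic_union mE mF l0 NF => /le_trans/(_ leF) h.
apply: (le_trans (ler_wpM2l M0 h)).
rewrite mulrA ler_pdivrMr; last by lra.
by rewrite mulrC ler_wpM2l//; lra.
Qed.

End stopping.

(** * Approximate values on cubes and their comparison *)

Section good_cubes.
Context {R : realType} {n : nat}.
Local Notation T := (lebesgueType R n).
Local Notation mu := (@lebesgue_rV R n).
Implicit Types (a b : 'rV[R]_n) (l k c d e lam : R) (h : T -> R) (E : set T).

Definition dev h c e : set T := [set x | e < `|h x - c|].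

Lemma measurable_absB h c : measurable_fun setT h ->
  measurable_fun setT (fun x => `|h x - c|).
Proof.
move=> mh; have mB := measurable_funB mh (measurable_cst c).
have mN : measurable_fun [set: R] (@Num.norm _ R) by exact: normr_measurable.
exact: (measurableT_comp mN mB).
Qed.

Lemma measurable_dev h c e : measurable_fun setT h -> measurable (dev h c e).
Proof.
move=> mh; rewrite (_ : dev h c e = (fun x => `|h x - c|) @^-1` `]e, +oo[).
  rewrite -[X in measurable X]setTI.
  by apply: (measurable_absB c mh measurableT); exact: measurable_itv.
by apply/seteqP; split => x; rewrite /= in_itv/= andbT.
Qed.

(** Real-valued form of a local oscillation at most [e], with the constant [c] exposed: constants
    can be compared from one cube to another, whereas an infimum hides them. *)
Definition good lam e h a l c : Prop := vol (dev h c e `&` hcube a l) <= lam * l ^+ n.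

Lemma hcube_meet (A B : set T) a l : measurable A -> measurable B -> 0 < l ->
  vol (A `&` hcube a l) + vol (B `&` hcube a l) < l ^+ n ->
  exists x, [/\ hcube a l x, ~ A x & ~ B x].
Proof.
move=> mA mB l0 lt; apply: contrapT => /forallNP H; move: lt; apply/negP.
have mQ := measurable_hcube a l.
have mA' := measurableI _ _ mA mQ; have mB' := measurableI _ _ mB mQ.
rewrite -leNgt.
apply: (le_trans _ (volU mA' mB' l0 (@subIsetr _ _ _) (@subIsetr _ _ _))).
rewrite -(vol_hcube a l0); apply: (vol_le (a := a) (l := l)) => //.
  exact: measurableU.
  by rewrite -setIUl; exact: subIsetr.
move=> x xl; have [Ax|Ax] := pselect (A x); first by left.
have [Bx|Bx] := pselect (B x); first by right.
by case: (H x).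
Qed.

Lemma good_mono lam lam' e e' h a l c : measurable_fun setT h -> 0 < l ->
  lam <= lam' -> e <= e' -> good lam e h a l c -> good lam' e' h a l c.
Proof.
move=> mh l0 ll ee; rewrite /good => g.
apply: le_trans (le_trans g _); last by rewrite ler_wpM2r// exprn_ge0// ltW.
have mQ := measurable_hcube a l.
apply: (vol_le (a := a) (l := l)) => //.
- by apply: measurableI => //; exact: measurable_dev.
- by apply: measurableI => //; exact: measurable_dev.
- by move=> x [dx xl]; split => //; rewrite /dev /=; exact: le_lt_trans dx.
Qed.

(** The condition on [lam] says that the two exceptional sets cannot cover the smaller cube, so [h]
    is within [e] of both values at some point. For equal cubes it amounts to [lam < 1/2]. *)
Lemma good_close lam e h a1 l1 c1 a2 l2 c2 : measurable_fun setT h -> 0 < l1 ->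
  0 < l2 -> hcube a1 l1 `<=` hcube a2 l2 -> lam * (l1 ^+ n + l2 ^+ n) < l1 ^+ n ->
  good lam e h a1 l1 c1 -> good lam e h a2 l2 c2 -> `|c1 - c2| <= 2 * e.
Proof.
move=> mh l10 l20 S lt g1 g2.
have m1 := measurable_dev c1 e mh; have m2 := measurable_dev c2 e mh.
have le2 : vol (dev h c2 e `&` hcube a1 l1) <= lam * l2 ^+ n.
  apply: le_trans g2; apply: (vol_le (a := a2) (l := l2)) => //.
  - by apply: measurableI => //; exact: measurable_hcube.
  - by apply: measurableI => //; exact: measurable_hcube.
  - exact: setIS.
have [] := @hcube_meet _ _ a1 l1 m1 m2 l10; first by move: g1; rewrite /good; lra.
move=> x [_ /negP + /negP]; rewrite -!leNgt => h1 h2.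
have -> : c1 - c2 = (h x - c2) - (h x - c1) by ring.
by apply: (le_trans (ler_normB _ _)); lra.
Qed.

Lemma bernoulli_le1 (t : R) m : 0 <= t <= 1 -> 1 - m%:R * t <= (1 - t) ^+ m.
Proof.
move=> /andP[t0 t1]; elim: m => [|m IHm]; first by rewrite expr0; lra.
rewrite exprS; apply: (@le_trans _ _ ((1 - t) * (1 - m%:R * t))); last first.
  by rewrite ler_wpM2l//; lra.
have : 0 <= m%:R * t * t by rewrite !mulr_ge0.
by rewrite -natr1; lra.
Qed.

(* Interpolate between the two cubes by cubes whose consecutive volumes are so
   close that, as [lam < 1/2], their good parts overlap. *)
Lemma good_chain lam K : 0 <= lam -> lam < 2^-1 -> 1 <= K ->
  exists2 C : R, 0 <= C & forall h e L a1 l1 c1 a2 l2 c2, measurable_fun setT h ->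
    0 <= e ->
    (forall a l, 0 < l -> l <= L -> exists c, good lam e h a l c) ->
    0 < l1 -> l2 <= K * l1 -> l2 <= L ->
    (forall i, a2 ord0 i <= a1 ord0 i /\ a1 ord0 i + l1 <= a2 ord0 i + l2) ->
    l1 <= l2 ->
    good lam e h a1 l1 c1 -> good lam e h a2 l2 c2 -> `|c1 - c2| <= C * e.
Proof.
move=> lam0 lam2 K1.
(* [t] is the relative change of side allowed in one step: by Bernoulli's inequality consecutive
   volumes have ratio at least [1 - n t], and [n t < 1 - 2 lam] makes [good_close] applicable. *)
pose t := (1 - 2 * lam) / n.+1%:R.
have n0 : (0 : R) < n.+1%:R by rewrite ltr0n.
have t0 : 0 < t by rewrite divr_gt0//; lra.
have nt : n.+1%:R * t = 1 - 2 * lam by rewrite /t mulrCA divff ?mulr1// gt_eqF.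
have nt' : n%:R * t + t = 1 - 2 * lam by rewrite -nt -natr1 mulrDl mul1r.
have nt0 : 0 <= n%:R * t by rewrite mulr_ge0// ltW.
have t1 : t <= 1 by lra.
(* With [m] steps the side grows each time by [(l2 - l1) / m <= (K - 1) * l1 / m <= t * l1]. *)
pose m := (Num.bound ((K - 1) / t)).+1.
have m0 : (0 : R) < m%:R by rewrite ltr0n.
have Kt : K - 1 <= m%:R * t.
  rewrite -ler_pdivrMr//; apply/ltW/(lt_le_trans (archi_boundP _)).
    by apply: divr_ge0; [lra|exact: ltW].
  by rewrite ler_nat.
(* There are [m] steps, plus one comparison of [c1] with another good value on the first cube; each
   costs [2 * e]. *)
exists (2 * m.+1%:R) => [//|h e L a1 l1 c1 a2 l2 c2 mh e0 HL l10 l2K l2L aa l12 g1 g2].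
pose s i : R := i%:R / m%:R.
pose l i := l1 + s i * (l2 - l1).
pose a i : 'rV[R]_n := \row_j (a1 ord0 j + s i * (a2 ord0 j - a1 ord0 j)).
have sS i : s i.+1 = s i + m%:R^-1 by rewrite /s -natr1 mulrDl mul1r.
have s0 i : 0 <= s i by rewrite divr_ge0// ler0n.
have s1 i : (i <= m)%N -> s i <= 1.
  by move=> im; rewrite /s ler_pdivrMr// mul1r ler_nat.
have l0 i : 0 < l i by rewrite ltr_pwDl// mulr_ge0// subr_ge0.
have lL i : (i <= m)%N -> l i <= L.
  move=> /s1 si; apply: le_trans l2L; rewrite /l.
  have : s i * (l2 - l1) <= 1 * (l2 - l1) by rewrite ler_wpM2r//; lra.
  by lra.
have llS i : (1 - t) * l i.+1 <= l i.
  have -> : l i = l i.+1 - m%:R^-1 * (l2 - l1) by rewrite /l sS; ring.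
  have : m%:R^-1 * (l2 - l1) <= t * l1.
    rewrite mulrC ler_pdivrMr//.
    have : (K - 1) * l1 <= m%:R * t * l1 by rewrite ler_wpM2r// ltW.
    by lra.
  have : t * l1 <= t * l i.+1.
    by rewrite ler_wpM2l// ?(ltW t0)// /l lerDl mulr_ge0// subr_ge0.
  by lra.
have sub i : hcube (a i) (l i) `<=` hcube (a i.+1) (l i.+1).
  have mi0 : 0 <= (m%:R^-1 : R) by rewrite invr_ge0 ltW.
  apply: hcubeS => j; have [h1 h2] := aa j; rewrite !mxE /l sS.
    have : 0 <= m%:R^-1 * (a1 ord0 j - a2 ord0 j) by rewrite mulr_ge0// subr_ge0.
    by lra.
  have : 0 <= m%:R^-1 * (a2 ord0 j + l2 - (a1 ord0 j + l1)) by rewrite mulr_ge0// subr_ge0.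
  by lra.
have lt i : lam * (l i ^+ n + l i.+1 ^+ n) < l i ^+ n.
  have h1 : (1 - n%:R * t) * l i.+1 ^+ n <= l i ^+ n.
    apply: (@le_trans _ _ (((1 - t) * l i.+1) ^+ n)).
      rewrite exprMn; apply: ler_wpM2r; first exact/exprn_ge0/ltW.
      by apply: bernoulli_le1; lra.
    apply: lerXn2r; rewrite ?nnegrE; [|exact: ltW|exact: llS].
    by apply: mulr_ge0; [lra|exact: ltW].
  have h2 : 0 < l i.+1 ^+ n by rewrite exprn_gt0.
  have : (1 - lam) * ((1 - n%:R * t) * l i.+1 ^+ n) <= (1 - lam) * l i ^+ n.
    by rewrite ler_wpM2l//; lra.
  have : lam * l i.+1 ^+ n < (1 - lam) * ((1 - n%:R * t) * l i.+1 ^+ n).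
    rewrite mulrA ltr_pM2r//.
    have : 0 <= lam * (n%:R * t) by rewrite mulr_ge0.
    by lra.
  by lra.
have main i c : (i <= m)%N -> good lam e h (a i) (l i) c ->
    `|c1 - c| <= 2 * i.+1%:R * e.
  elim: i c => [|i IHi] c im g.
    rewrite mulr1; apply: good_close g1 g => //.
    - move=> x; suff -> : a 0%N = a1 by rewrite /l /s mul0r mul0r addr0.
      by apply/rowP => j; rewrite mxE /s !mul0r addr0.
    - rewrite /l /s !mul0r addr0.
      have : 0 < l1 ^+ n by rewrite exprn_gt0.
      by nra.
  have [d gd] := HL (a i) (l i) (l0 i) (lL _ (ltnW im)).
  have h1 := IHi d (ltnW im) gd.
  have h2 := good_close mh (l0 i) (l0 i.+1) (@sub i) (lt i) gd g.
  have -> : c1 - c = (c1 - d) + (d - c) by ring.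
  apply: (le_trans (ler_normD _ _)).
  by rewrite -(natr1 i.+1); lra.
have := main m c2 (leqnn m); rewrite (_ : l m = l2); last first.
  by rewrite /l /s divff ?gt_eqF//; ring.
rewrite (_ : a m = a2); last first.
  by apply/rowP => j; rewrite mxE /s divff ?gt_eqF//; ring.
by apply.
Qed.

End good_cubes.

Section integral_bounds.
Context d (T : measurableType d) (R : realType) (mu : {measure set T -> \bar R}).
Implicit Types (f g : T -> R) (A E : set T).
Local Open Scope ereal_scope.

Lemma ge0_integral_le f g A : measurable A -> measurable_fun setT f ->
  measurable_fun setT g -> (forall x, 0 <= f x)%R ->
  (forall x, A x -> f x <= g x)%R ->
  \int[mu]_(x in A) (f x)%:E <= \int[mu]_(x in A) (g x)%:E.
Proof.
move=> mA mf mg f0 fg.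
have mE (h : T -> R) : measurable_fun setT h -> measurable_fun A (EFin \o h).
  by move=> mh; apply/measurable_EFinP; exact: measurable_funTS.
apply: (ge0_le_integral mu mA _ (mE f mf) (mE g mg)).
- by move=> x _; rewrite lee_fin.
- by move=> x Ax; rewrite lee_fin; exact: fg.
Qed.

Lemma ge0_integral_leD f g (r : R) A : measurable A -> measurable_fun setT f ->
  measurable_fun setT g -> (forall x, 0 <= f x)%R -> (forall x, 0 <= g x)%R ->
  (0 <= r)%R -> (forall x, A x -> f x <= g x + r)%R ->
  \int[mu]_(x in A) (f x)%:E <= \int[mu]_(x in A) (g x)%:E + r%:E * mu A.
Proof.
move=> mA mf mg f0 g0 r0 fg.
have gE x : A x -> (0 <= (g x)%:E) by rewrite lee_fin.
have rE x : A x -> (0 <= cst r%:E x) by rewrite lee_fin.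
have mgE : measurable_fun A (EFin \o g).
  by apply/measurable_EFinP; exact: measurable_funTS.
have mr : measurable_fun A (cst r%:E : T -> \bar R) by exact: measurable_cst.
rewrite -(integral_cst mu mA) -(ge0_integralD mu mA gE mgE rE mr).
have mgr := measurable_funD mg (measurable_cst r).
exact: (ge0_integral_le mA mf mgr f0 fg).
Qed.

Lemma ge0_integral_split f A E : measurable A -> measurable E ->
  measurable_fun setT f -> (forall x, 0 <= f x)%R ->
  \int[mu]_(x in A) (f x)%:E =
  \int[mu]_(x in E `&` A) (f x)%:E + \int[mu]_(x in A `\` E) (f x)%:E.
Proof.
move=> mA mE mf f0; rewrite -ge0_integral_setU//.
- by rewrite setIC setUIDK.
- exact: measurableI.
- exact: measurableD.
- by apply/measurable_EFinP; exact: measurable_funTS.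
- by move=> x _; rewrite lee_fin.
- by apply/disj_setPS => x [[Ex _] [_]].
Qed.

End integral_bounds.

(** * Mean oscillation of bounded functions *)

Section john_stromberg.
Context {R : realType} {n : nat}.
Local Notation T := (lebesgueType R n).
Local Notation mu := (@lebesgue_rV R n).
Implicit Types (a b : 'rV[R]_n) (l k c d e lam M : R) (h phi psi : T -> R)
  (A B E : set T).

Lemma Int_ge0 phi A : (forall x, 0 <= phi x) -> 0 <= Int phi A.
Proof.
by move=> p0; apply/fine_ge0/integral_ge0 => x _; rewrite lee_fin.
Qed.

Lemma Int_split phi M E a l : measurable E -> 0 < l ->
  measurable_fun setT phi -> (forall x, 0 <= phi x <= M) ->
  Int phi (hcube a l) = Int phi (E `&` hcube a l) + Int phi (hcube a l `\` E).
Proof.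
move=> mE l0 mphi pM; have mQ := measurable_hcube a l.
have mI := measurableI _ _ mE mQ; have mD := measurableD mQ mE.
have p0 x : 0 <= phi x by case/andP: (pM x).
apply: EFin_inj; rewrite EFinD -(IntE mQ l0 (@subset_refl _ _) mphi pM).
rewrite -(IntE mI l0 (@subIsetr _ _ _) mphi pM).
rewrite -(IntE mD l0 (@subDsetl _ _ _) mphi pM).
exact: (ge0_integral_split mu mQ mE mphi p0).
Qed.

Lemma Int_le_cst phi M e A a l : measurable A -> 0 < l -> A `<=` hcube a l ->
  measurable_fun setT phi -> (forall x, 0 <= phi x <= M) ->
  (forall x, A x -> phi x <= e) -> Int phi A <= e * vol A.
Proof.
move=> mA l0 Al mphi pM pe.
have p0 x : 0 <= phi x by case/andP: (pM x).
rewrite -lee_fin -(IntE mA l0 Al mphi pM) EFinM -(volE mA Al l0).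
rewrite -(integral_cst mu mA).
exact: (ge0_integral_le mu mA mphi (measurable_cst e) p0 pe).
Qed.

Lemma Int_leD phi psi M d A a l : measurable A -> 0 < l -> A `<=` hcube a l ->
  measurable_fun setT phi -> measurable_fun setT psi ->
  (forall x, 0 <= phi x <= M) -> (forall x, 0 <= psi x <= M) -> 0 <= d ->
  (forall x, phi x <= psi x + d) -> Int phi A <= Int psi A + d * vol A.
Proof.
move=> mA l0 Al mphi mpsi phiM psiM d0 H.
have p0 x : 0 <= phi x by case/andP: (phiM x).
have q0 x : 0 <= psi x by case/andP: (psiM x).
rewrite -lee_fin EFinD EFinM -(volE mA Al l0) -(IntE mA l0 Al mphi phiM).
rewrite -(IntE mA l0 Al mpsi psiM).
exact: (ge0_integral_leD mu mA mphi mpsi p0 q0 d0 (fun x _ => H x)).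
Qed.

(** Some point of the cube is not exceptional. The bound keeps finite the supremum over all cubes in
    the absorption argument. *)
Lemma good_bound lam e h M a l c : lam < 1 -> measurable_fun setT h ->
  0 < l -> (forall x, `|h x| <= M) -> good lam e h a l c -> `|c| <= M + e.
Proof.
move=> lam1 mh l0 hM g.
have [|x [_ /negP + _]] := hcube_meet (a := a) (measurable_dev c e mh)
    (@measurable0 _ T) l0.
  rewrite set0I /vol measure0/= addr0; apply: (le_lt_trans g).
  by rewrite gtr_pMl// exprn_gt0.
rewrite -leNgt => hx.
have -> : c = h x - (h x - c) by ring.
by apply: (le_trans (ler_normB _ _)); apply: lerD.
Qed.

Lemma john_stromberg_bounded lam : 0 <= lam -> lam < 2^-1 ->
  exists2 C : R, 0 <= C & forall h e M, measurable_fun setT h -> 0 <= e ->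
    (forall x, `|h x| <= M) ->
    (forall a l, 0 < l -> exists c, good lam e h a l c) ->
    forall a l c, 0 < l -> good lam e h a l c ->
    Int (fun x => `|h x - c|) (hcube a l) <= C * e * l ^+ n.
Proof.
move=> lam0 lam2; have h12 : (1 : R) <= 2 by lra.
have [C1 C10 chain] := @good_chain R n lam 2 lam0 lam2 h12.
(* The quotient comes from solving the absorption inequality for the supremum; the final [2] is the
   price of replacing the selected value on a cube by an arbitrary good one. *)
exists ((2 * lam * (C1 + 2) + 1) / (1 - 2 * lam) + 2) => [|h e M mh e0 hM HG a0 l0' c0 l00 g0].
  rewrite addr_ge0// divr_ge0//; last by lra.
  by rewrite addr_ge0// mulr_ge0//; lra.
(* One good value is selected per cube, so that the oscillation around it is a function of the cube
   and its supremum makes sense. *)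
have [cc Hcc] : {cc : 'rV[R]_n * R -> R &
    forall p, 0 < p.2 -> good lam e h p.1 p.2 (cc p)}.
  apply: (@boolp.choice _ _ (fun p c => 0 < p.2 -> good lam e h p.1 p.2 c)) => -[a l].
  have [l0|_] := ltrP 0 l; last by exists 0.
  by have [c gc] := HG a l l0; exists c.
have {}Hcc a l : 0 < l -> good lam e h a l (cc (a, l)) by move=> ?; exact: (Hcc (a, l)).
have M0 : 0 <= M by apply: le_trans (hM 0).
have mphi c := measurable_absB c mh.
have phiM c x : 0 <= `|h x - c| <= M + `|c|.
  by rewrite normr_ge0/= (le_trans (ler_normB _ _))// lerD2r.
have ccM a l : 0 < l -> `|cc (a, l)| <= M + e.
  by move=> l0; apply: good_bound (Hcc _ _ l0) => //; lra.
pose N a l := Int (fun x => `|h x - cc (a, l)|) (hcube a l) / l ^+ n.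
pose S := [set r | exists a l, 0 < l /\ r = N a l].
have ubS : has_ubound S.
  exists (M + (M + e)) => _ [a [l [l1 ->]]].
  rewrite /N ler_pdivrMr ?exprn_gt0// -(vol_hcube a l1).
  apply: (Int_le_vol (a := a) (l := l)) => // [|x]; first exact: measurable_hcube.
  have /andP[-> h1] := phiM (cc (a, l)) x; have := ccM a l l1.
  by move: h1; lra.
(* The stopping-time argument yields [X <= 2 lam (X + (C1 + 2) e) + e], which
   bounds [X] since [2 lam < 1]; it is finite because [h] is bounded. *)
pose X := sup S.
have NX a l : 0 < l -> Int (fun x => `|h x - cc (a, l)|) (hcube a l) <= X * l ^+ n.
  move=> l1; rewrite -ler_pdivrMr ?exprn_gt0//.
  by apply: (ub_le_sup ubS); exists a, l.
have X0 : 0 <= X.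
  have := NX 0 1 ltr01; rewrite expr1n mulr1; apply: le_trans.
  by apply: Int_ge0 => x.
have step a l : 0 < l -> N a l <= 2 * lam * (X + (C1 + 2) * e) + e.
  move=> l1; set c := cc (a, l); rewrite /N ler_pdivrMr ?exprn_gt0//.
  pose phi x := `|h x - c|; pose E := dev h c e.
  have mE : measurable E by exact: measurable_dev.
  have g : good lam e h a l c by exact: Hcc.
  have mQ b k := measurable_hcube (n := n) b k.
  have mI b k := measurableI _ _ mE (mQ b k).
  rewrite (Int_split a mE l1 (mphi c) (phiM c)).
  have K0 : 0 <= X + (C1 + 2) * e by rewrite addr_ge0// mulr_ge0//; lra.
  have Mc0 : 0 <= M + `|c| by rewrite addr_ge0.
  have h1 : Int phi (hcube a l `\` E) <= e * l ^+ n.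
    rewrite -(vol_hcube a l1).
    apply: le_trans (_ : e * vol (hcube a l `\` E) <= _).
      apply: (Int_le_cst (a := a) (l := l)) (mphi c) (phiM c) _ => //.
        exact: measurableD.
      by move=> x [_ /negP]; rewrite -leNgt.
    rewrite ler_wpM2l//; apply: (vol_le (a := a) (l := l)) => //.
    exact: measurableD.
  (* Stopping argument with [K = X + (C1 + 2) * e]: a child of a light cube has mean oscillation at
     most [X] around its own value, which is [C1 * e] away from that of its parent, which is [2 * e]
     away from [c], because [lam + 1/2 < 1] leaves in the parent a point that is good for both. *)
  have h2 : Int phi (E `&` hcube a l) <=
      2 * (X + (C1 + 2) * e) * vol (E `&` hcube a l).
    apply: (stopping (M := M + `|c|)) => //.
    - exact: Int_additive (mphi c) (phiM c).
    - by move=> A; apply: Int_ge0 => x; exact: normr_ge0.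
    - move=> b k k0.
      exact: (Int_le (mI b k) (mQ b k) k0 (@subset_refl _ _) (@subIsetr _ _ _) (mphi c) (phiM c)).
    - move=> b k k0.
      exact: (Int_le_vol (mI b k) k0 (@subIsetr _ _ _) (mphi c) (phiM c)).
    - move=> b k k0 lE e'; have k20 : 0 < k / 2 by lra.
      set b' := child b k e'.
      have d1 : `|cc (b', k / 2) - cc (b, k)| <= C1 * e.
        apply: (chain h e k b' (k / 2) _ b k _) => //.
        - by move=> ? ? ? _; exact: HG.
        - by lra.
        - by move=> i; exact: child_itv.
        - by lra.
        - exact: Hcc.
        - exact: Hcc.
      have d2 : `|cc (b, k) - c| <= 2 * e.
        have [|x [_ /negP + /negP]] := hcube_meet (a := b)
          (measurable_dev (cc (b, k)) e mh) mE k0.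
          have := Hcc b k k0; rewrite /good => gb.
          have : lam * k ^+ n < 2^-1 * k ^+ n by rewrite ltr_pM2r// exprn_gt0.
          by move: gb lE; lra.
        rewrite -!leNgt => x1 x2.
        have -> : cc (b, k) - c = (h x - c) - (h x - cc (b, k)) by ring.
        by apply: (le_trans (ler_normB _ _)); lra.
      have pM1 (c' : R) x : 0 <= `|h x - c'| <= M + `|c| + `|c'|.
        have /andP[-> /=] := phiM c' x; have : 0 <= `|c| by [].
        by lra.
      have pMc x : 0 <= `|h x - c| <= M + `|c| + `|cc (b', k / 2)|.
        have /andP[-> /=] := phiM c x; have : 0 <= `|cc (b', k / 2)| by [].
        by lra.
      have Ce0 : 0 <= C1 * e + 2 * e by rewrite addr_ge0// mulr_ge0.
      have := @Int_leD phi (fun x => `|h x - cc (b', k / 2)|) _ (C1 * e + 2 * e)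
        _ _ _ (mQ b' (k / 2)) k20 (@subset_refl _ _) (mphi c) (mphi _)
        pMc (pM1 _) Ce0.
      rewrite vol_hcube// => /(_ _)/le_trans; apply.
        move=> x; rewrite /phi.
        have -> : h x - c = (h x - cc (b', k / 2)) +
          ((cc (b', k / 2) - cc (b, k)) + (cc (b, k) - c)) by ring.
        apply: (le_trans (ler_normD _ _)); rewrite lerD2l.
        by apply: (le_trans (ler_normD _ _)); exact: lerD.
      have := NX b' (k / 2) k20.
      by lra.
    - apply: (le_trans g); have : lam * l ^+ n <= 2^-1 * l ^+ n.
        by rewrite ler_wpM2r ?exprn_ge0 ?(ltW l1)// ltW.
      by lra.
  have h3 : 2 * (X + (C1 + 2) * e) * vol (E `&` hcube a l) <=
      2 * (X + (C1 + 2) * e) * (lam * l ^+ n).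
    by rewrite ler_wpM2l// mulr_ge0.
  by move: h1 h2 h3; rewrite /phi; lra.
have XX : X <= 2 * lam * (X + (C1 + 2) * e) + e.
  apply: ge_sup; first by exists (N 0 1), 0, 1; split.
  by move=> _ [a [l [l1 ->]]]; exact: step.
have XC : X <= (2 * lam * (C1 + 2) + 1) / (1 - 2 * lam) * e.
  rewrite mulrAC ler_pdivlMr; last by lra.
  by move: XX; lra.
have dc : `|cc (a0, l0') - c0| <= 2 * e.
  apply: good_close (Hcc a0 l0' l00) g0 => //.
  have : 0 < l0' ^+ n by rewrite exprn_gt0.
  by nra.
have pM1 (c' : R) x : 0 <= `|h x - c'| <= M + `|c0| + `|c'|.
  have /andP[-> /=] := phiM c' x; have : 0 <= `|c0| by [].
  by lra.
have pMc x : 0 <= `|h x - c0| <= M + `|c0| + `|cc (a0, l0')|.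
  have /andP[-> /=] := phiM c0 x; have : 0 <= `|cc (a0, l0')| by [].
  by lra.
have e20 : 0 <= 2 * e by lra.
have := @Int_leD (fun x => `|h x - c0|) (fun x => `|h x - cc (a0, l0')|) _ (2 * e)
  _ _ _ (measurable_hcube a0 l0') l00 (@subset_refl _ _) (mphi c0) (mphi _)
  pMc (pM1 _) e20.
rewrite vol_hcube// => /(_ _)/le_trans; apply.
  move=> x; have -> : h x - c0 = (h x - cc (a0, l0')) + (cc (a0, l0') - c0) by ring.
  by apply: (le_trans (ler_normD _ _)); rewrite lerD2l.
have : X * l0' ^+ n <= (2 * lam * (C1 + 2) + 1) / (1 - 2 * lam) * e * l0' ^+ n.
  by rewrite ler_wpM2r// exprn_ge0// ltW.
have := NX a0 l0' l00; lra.
Qed.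

End john_stromberg.

Section clamp.
Context {R : realType}.
Implicit Types (k x y : R).

Definition clamp k x : R := Num.max (- k) (Num.min x k).

Lemma clampE k x : 0 <= k ->
  clamp k x = if x < - k then - k else if k < x then k else x.
Proof.
move=> k0; rewrite /clamp; case: ifPn => [h|]; last rewrite -leNgt => h.
  by rewrite (min_idPl _) ?(max_idPl _)//; lra.
case: ifPn => [h'|]; last rewrite -leNgt => h'.
  by rewrite (min_idPr _) ?(max_idPr _)//; lra.
by rewrite (min_idPl _) ?(max_idPr _)//; lra.
Qed.

Lemma clamp_norm k x : 0 <= k -> `|clamp k x| <= k.
Proof.
move=> k0; rewrite clampE// ler_norml.
by case: (ltrP x (- k)) => h; [|case: (ltrP k x) => h'];
  apply/andP; split; lra.
Qed.

Lemma clamp_id k x : `|x| <= k -> clamp k x = x.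
Proof.
move=> xk; have k0 := le_trans (normr_ge0 x) xk; move: xk.
rewrite ler_norml clampE// => /andP[h1 h2].
by case: (ltrP x (- k)) => h; [lra|case: (ltrP k x) => h'; lra].
Qed.

Lemma clamp_lip k x y : 0 <= k -> `|clamp k x - clamp k y| <= `|x - y|.
Proof.
move=> k0; have := ler_norm (x - y); have := ler_norm (y - x); rewrite (distrC y x).
rewrite ler_norml !clampE//.
by case: (ltrP x (- k)) => h1; case: (ltrP k x) => h2; case: (ltrP y (- k)) => h3;
  case: (ltrP k y) => h4 h5 h6; apply/andP; split; lra.
Qed.

(** This lets the remainder of a function after truncation inherit its good values, just as the
    truncation does. *)
Lemma clamp_res_lip k x y : 0 <= k ->
  `|(x - clamp k x) - (y - clamp k y)| <= `|x - y|.
Proof.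
move=> k0; have := ler_norm (x - y); have := ler_norm (y - x); rewrite (distrC y x).
rewrite ler_norml !clampE//.
by case: (ltrP x (- k)) => h1; case: (ltrP k x) => h2; case: (ltrP y (- k)) => h3;
  case: (ltrP k y) => h4 h5 h6; apply/andP; split; lra.
Qed.

Lemma clamp_clamp k k' x : 0 <= k -> k <= k' -> clamp k (clamp k' x) = clamp k x.
Proof.
move=> k0 kk; have k'0 := le_trans k0 kk; rewrite (clampE x k'0).
do 2?[case: ifPn; rewrite -?leNgt => ?]; rewrite !clampE//;
  by do ![case: ifPn; rewrite -?leNgt => ?]; lra.
Qed.

Lemma clamp_mono k k' x y : 0 <= k -> k <= k' ->
  `|clamp k x - clamp k y| <= `|clamp k' x - clamp k' y|.
Proof.
by move=> k0 kk; rewrite -(clamp_clamp x k0 kk) -(clamp_clamp y k0 kk); exact: clamp_lip.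
Qed.

End clamp.

Section measurable_clamp.
Context d (T : measurableType d) (R : realType) (mu : {measure set T -> \bar R}).
Implicit Types (h : T -> R).

Lemma measurable_clamp k h : measurable_fun setT h ->
  measurable_fun setT (fun x => clamp k (h x)).
Proof.
move=> mh; have mm := measurable_minr mh (measurable_cst k).
exact: (measurable_maxr (measurable_cst (- k)) mm).
Qed.

(** The truncated oscillations increase with [k] and are equal to [|h x - c|] once [k] exceeds
    [|h x| + |c|], so monotone convergence carries the uniform bound to the limit. *)
Lemma integral_clamp_le h c (B : R) (A : set T) : measurable A ->
  measurable_fun setT h ->
  (forall k : nat,
    \int[mu]_(x in A) (`|clamp k%:R (h x) - clamp k%:R c|)%:E <= B%:E)%E ->
  (\int[mu]_(x in A) (`|h x - c|)%:E <= B%:E)%E.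
Proof.
move=> mA mh H.
pose g (k : nat) x : \bar R := (`|clamp k%:R (h x) - clamp k%:R c|)%:E.
have mg k : measurable_fun A (g k).
  apply: measurable_funTS; apply/measurable_EFinP.
  have mB := measurable_funB (measurable_clamp k%:R mh)
    (measurable_cst (clamp k%:R c)).
  have mN : measurable_fun [set: R] (@Num.norm _ R) by exact: normr_measurable.
  exact: (measurableT_comp mN mB).
have g0 k x : A x -> (0 <= g k x)%E by rewrite lee_fin.
have ndg x : A x -> {homo g ^~ x : i j / (i <= j)%N >-> (i <= j)%E}.
  by move=> _ i j ij; rewrite lee_fin clamp_mono// ler_nat.
have gl x : limn (g ^~ x) = (`|h x - c|)%:E.
  apply/cvg_lim => //; apply: cvg_near_cst.
  exists (Num.bound (`|h x| + `|c|)) => // k /= hk.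
  have : `|h x| + `|c| <= k%:R.
    apply/ltW/(lt_le_trans (archi_boundP _)); first by rewrite addr_ge0.
    by rewrite ler_nat.
  move=> hk'; rewrite /g !clamp_id//.
    by apply: le_trans hk'; rewrite lerDr.
  by apply: le_trans hk'; rewrite lerDl.
have := monotone_convergence mu mA mg g0 ndg.
under eq_integral do rewrite gl.
move=> ->; apply: lime_le.
  apply: ereal_nondecreasing_is_cvgn => i j ij.
  by apply: (ge0_le_integral mu mA (g0 i) (mg i) (mg j)) => x Ax; exact: ndg.
by apply: nearW => k; exact: H.
Qed.

End measurable_clamp.

Section john_stromberg.
Context {R : realType} {n : nat}.
Local Notation T := (lebesgueType R n).
Local Notation mu := (@lebesgue_rV R n).
Implicit Types (a b : 'rV[R]_n) (l k c d e lam M tau : R) (h : T -> R)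
  (A B E S : set T).

(** The exceptional set for [h'] lies in the union of the one for [h] and [S], so a modification
    controlled off [S] costs only the fraction [tau]. *)
Lemma good_transfer lam tau e e' h h' a l c c' S : measurable_fun setT h ->
  measurable_fun setT h' -> 0 < l -> measurable S ->
  vol (S `&` hcube a l) <= tau * l ^+ n ->
  (forall x, hcube a l x -> ~ S x -> `|h x - c| <= e -> `|h' x - c'| <= e') ->
  good lam e h a l c -> good (lam + tau) e' h' a l c'.
Proof.
move=> mh mh' l0 mS volS H; rewrite /good => g.
have mQ := measurable_hcube a l.
have m1 := measurableI _ _ (measurable_dev c e mh) mQ.
have m2 := measurableI _ _ (measurable_dev c' e' mh') mQ.
have mSQ := measurableI _ _ mS mQ.
have := volU m1 mSQ l0 (@subIsetr _ _ _) (@subIsetr _ _ _).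
have : vol (dev h' c' e' `&` hcube a l) <= vol (dev h c e `&` hcube a l `|` S `&` hcube a l).
  apply: (vol_le (a := a) (l := l)) => //.
  - exact: measurableU.
  - by rewrite -setIUl; exact: subIsetr.
  move=> x [dx xl]; have [Sx|Sx] := pselect (S x); [by right; split|left; split => //].
  rewrite /dev /= ltNge; apply/negP => /(H x xl Sx); move: dx; rewrite /dev /=.
  by rewrite ltNge => /negP.
by rewrite mulrDl; lra.
Qed.

Lemma good_transfer0 lam e e' h h' a l c c' : measurable_fun setT h ->
  measurable_fun setT h' -> 0 < l ->
  (forall x, hcube a l x -> `|h x - c| <= e -> `|h' x - c'| <= e') ->
  good lam e h a l c -> good lam e' h' a l c'.
Proof.
move=> mh mh' l0 H g; rewrite -(addr0 lam).
apply: (good_transfer (S := set0)) g => //; last by move=> x xl _; exact: H.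
by rewrite set0I /vol measure0 mul0r.
Qed.

(** Truncations of [h] keep its good values because [clamp] is 1-Lipschitz, and the constant of the
    bounded case does not depend on the level. *)
Lemma john_stromberg lam : 0 <= lam -> lam < 2^-1 ->
  exists2 C : R, 0 <= C & forall h e, measurable_fun setT h -> 0 <= e ->
    (forall a l, 0 < l -> exists c, good lam e h a l c) ->
    forall a l c, 0 < l -> good lam e h a l c ->
    (\int[mu]_(x in hcube a l) (`|h x - c|)%:E <= (C * e * l ^+ n)%:E)%E.
Proof.
move=> lam0 lam2; have [C C0 H] := @john_stromberg_bounded R n lam lam0 lam2.
exists C => // h e mh e0 HG a l c l0 g.
have mQ := measurable_hcube a l.
apply: (integral_clamp_le mQ mh) => k.
have mk := measurable_clamp k%:R mh.
have gk b r d : 0 < r -> good lam e h b r d ->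
    good lam e (fun x => clamp k%:R (h x)) b r (clamp k%:R d).
  move=> r0; apply: good_transfer0 => // x _; apply: le_trans.
  exact: clamp_lip.
have kM x : `|clamp k%:R (h x)| <= k%:R by exact: clamp_norm.
have := H _ e k%:R mk e0 kM _ a l _ l0 (gk _ _ _ l0 g) => /(_ _).
rewrite -lee_fin -(IntE (M := k%:R + k%:R) mQ l0 (@subset_refl _ _)).
- apply=> b r r0; have [d gd] := HG b r r0.
  by exists (clamp k%:R d); exact: gk.
- exact: measurable_absB.
- move=> x; rewrite normr_ge0/=; apply: (le_trans (ler_normB _ _)).
  by apply: lerD; exact: clamp_norm.
Qed.

End john_stromberg.

Lemma markov_abs d (T : measurableType d) (R : realType)
    (mu : {measure set T -> \bar R}) (h : T -> R) (A : set T) (M : R) :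
  measurable A -> measurable_fun setT h -> 0 < M ->
  (M%:E * mu ([set x | (M < `|h x|)%R] `&` A) <= \int[mu]_(x in A) (`|h x|)%:E)%E.
Proof.
move=> mA mh M0.
have mN : measurable_fun [set: R] (@Num.norm _ R) by exact: normr_measurable.
have mhA : measurable_fun A (EFin \o h).
  by apply/measurable_EFinP; exact: measurable_funTS.
have := le_integral_abse mu mA mhA M0; rewrite /= => /(le_trans _); apply.
rewrite lee_pmul2l//; apply: le_measure; rewrite ?inE.
- apply: measurableI => //.
  have := measurableT_comp mN mh measurableT (measurable_itv `]M, +oo[).
  rewrite setTI; congr measurable.
  by apply/seteqP; split => x; rewrite /= in_itv/= andbT.
- apply: measurableI => //.
  have := measurableT_comp mN mh measurableT (measurable_itv `[M, +oo[).
  rewrite setTI; congr measurable.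
  by apply/seteqP; split => x; rewrite /= in_itv/= andbT lee_fin.
- by move=> x [/ltW hx Ax]; split => //=.
Qed.

(** * Truncation and cutoff *)

Section truncation.
Context {R : realType} {n : nat}.
Local Notation T := (lebesgueType R n).
Local Notation mu := (@lebesgue_rV R n).
Implicit Types (a b : 'rV[R]_n) (l k c d e lam M tau : R) (h : T -> R)
  (A B E S : set T).

Definition ccube (r : R) : set T := hcube (const_mx (- r)) (2 * r).

Lemma ccubeE r x : ccube r x <-> forall i, - r <= (x : 'rV[R]_n) ord0 i < r.
Proof. by split=> + i => /(_ i); rewrite mxE; lra. Qed.

Lemma measurable_ccube r : measurable (ccube r).
Proof. exact: measurable_hcube. Qed.

Lemma ccubeS r s : r <= s -> ccube r `<=` ccube s.
Proof. by move=> rs x /ccubeE h; apply/ccubeE => i; have := h i; lra. Qed.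

Definition extreme_cube (dl L d : R) a l : Prop :=
  [\/ l <= dl, L <= l | hcube a l `&` ccube d = set0].

(** The three limit conditions at once, for a real function: given [e], only cubes of intermediate
    size that meet a fixed cube around the origin may lack a good value. *)
Definition vanishing_osc lam h : Prop := forall e, 0 < e ->
  exists dl L d, [/\ 0 < dl, 0 < L, 0 < d & forall a l, 0 < l ->
    extreme_cube dl L d a l -> exists c, good lam e h a l c].

Lemma not_extreme dl L d a l : ~ extreme_cube dl L d a l ->
  [/\ dl < l, l < L & hcube a l `<=` ccube (d + L)].
Proof.
move=> H.
have h1 : dl < l by rewrite ltNge; apply/negP => ?; apply: H; exact: Or31.
have h2 : l < L by rewrite ltNge; apply/negP => ?; apply: H; exact: Or32.
split => // x xl; have [y [yl yd]] : hcube a l `&` ccube d !=set0.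
  by apply/set0P/eqP => ?; apply: H; exact: Or33.
apply/ccubeE => i; have := xl i; have := yl i; have := (ccubeE d y).1 yd i.
by lra.
Qed.

(** On extreme cubes the remainder inherits good values from [h]. All other cubes lie in one bounded
    cube [B] and have side above [dl]; there 0 is a good value as soon as [|h| > M] holds on at most
    the volume [lam * dl ^+ n] of [B]. *)
Lemma truncation lam h e : 0 < lam -> measurable_fun setT h ->
  (forall a l, 0 < l -> (\int[mu]_(x in hcube a l) (`|h x|)%:E < +oo)%E) ->
  vanishing_osc lam h -> 0 < e ->
  exists2 M, 0 < M & forall a l, 0 < l ->
    exists c, good lam e (fun x => h x - clamp M (h x)) a l c.
Proof.
move=> lam0 mh hloc hv e0; have [dl [L [d [dl0 L0 d0 H]]]] := hv e e0.
pose B := ccube (d + L).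
have s0 : 0 < 2 * (d + L) by lra.
have mB : measurable B := measurable_ccube _.
have [I IE] : exists I : R, (\int[mu]_(x in B) (`|h x|)%:E)%E = I%:E.
  exists (Int (fun x => `|h x|) B); rewrite /Int fineK// ge0_fin_numE.
    exact: hloc.
  by apply: integral_ge0 => x _; rewrite lee_fin.
have I0 : 0 <= I by rewrite -lee_fin -IE; apply: integral_ge0 => x _; rewrite lee_fin.
pose t := lam * dl ^+ n.
have t0 : 0 < t by rewrite mulr_gt0// exprn_gt0.
(* Markov's inequality asks for [I / M <= t]; the [+ 1] keeps [M] positive when [I] is 0. *)
pose M := (I + 1) / t.
have M0 : 0 < M by rewrite divr_gt0//; lra.
have m0 : measurable (dev h 0 M) by exact: measurable_dev.
have mBM := measurableI _ _ m0 mB.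
have volM : vol (dev h 0 M `&` B) <= t.
  have := markov_abs mu mB (measurable_absB 0 mh) M0.
  rewrite [X in (_ <= X)%E](_ : _ = I%:E); last first.
    by rewrite -IE; apply: eq_integral => x _; rewrite subr0 normr_id.
  rewrite (_ : [set x | _] = dev h 0 M); last first.
    by apply/seteqP; split => x; rewrite /dev /= normr_id.
  rewrite (volE mBM (@subIsetr _ _ _) s0) -EFinM lee_fin.
  rewrite mulrC -ler_pdivlMr// => /le_trans; apply.
  by rewrite /M invf_div mulrA ler_pdivrMr; nra.
exists M => // a l l0.
have mr : measurable_fun setT (fun x => h x - clamp M (h x)).
  exact: (measurable_funB mh (measurable_clamp M mh)).
have [ex|/not_extreme[lt1 lt2 S]] := pselect (extreme_cube dl L d a l).
  have [c g] := H a l l0 ex; exists (c - clamp M c).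
  apply: good_transfer0 g => // x _; apply: le_trans.
  by apply: clamp_res_lip; exact: ltW.
exists 0; rewrite /good.
apply: (@le_trans _ _ (vol (dev h 0 M `&` B))); last first.
  apply: (le_trans volM); rewrite /t ler_pM2l//.
  by apply: lerXn2r; rewrite ?nnegrE; lra.
apply: (vol_le (a := const_mx (- (d + L))) (l := 2 * (d + L))) => //.
  by apply: measurableI; [exact: measurable_dev|exact: measurable_hcube].
move=> x [hx xl]; split; last exact: S.
move: hx; rewrite /dev /= !subr0 => hx; rewrite ltNge; apply/negP => hM.
by move: hx; rewrite clamp_id// subrr normr0; lra.
Qed.

Section cutoff.
Variables (R0 tau : R) (N : nat).
Hypotheses (R00 : 0 < R0) (tau0 : 0 < tau) (tau1 : tau <= 1) (N0 : (0 < N)%N).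
Hypothesis n0 : (0 < n)%N.

Let r (k : nat) : R := R0 * (1 + 2 / tau) ^+ k.

Let t0 : 0 < 2 / tau. Proof. by rewrite divr_gt0. Qed.

Let r0 (k : nat) : 0 < r k.
Proof. by rewrite mulr_gt0// exprn_gt0//; move: t0; lra. Qed.

Let rS (k : nat) : r k.+1 = r k + 2 * r k / tau.
Proof. by rewrite /r exprS; ring. Qed.

Let r_le (j k : nat) : (j <= k)%N -> r j <= r k.
Proof.
move=> jk; rewrite /r ler_pM2l//; apply: ler_weXn2l => //.
by move: t0; lra.
Qed.

(* The radii grow so fast that a cube crossing the boundaries of two of the
   [ccube (r k)] meets only a fraction [tau] of the smaller one: off that
   fraction, at most one indicator varies on the cube. *)
Definition cutoff (x : T) : R := N%:R^-1 * \sum_(k < N) \1_(ccube (r k)) x.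

Lemma measurable_cutoff : measurable_fun setT cutoff.
Proof.
apply: measurable_funM; first exact: measurable_cst.
apply: measurable_sum => k; apply: measurable_indic; exact: measurable_ccube.
Qed.

Let NR0 : (0 : R) < N%:R. Proof. by rewrite ltr0n. Qed.

Let ind01 (k : nat) x : 0 <= (\1_(ccube (r k)) x : R) <= 1.
Proof. by rewrite indicE; case: (_ \in _); rewrite ?lexx ?ler01. Qed.

Lemma cutoff01 x : 0 <= cutoff x <= 1.
Proof.
apply/andP; split.
  by rewrite mulr_ge0 ?invr_ge0 ?ler0n//; apply: sumr_ge0 => k _; case/andP: (ind01 k x).
rewrite /cutoff mulrC ler_pdivrMr// mul1r.
apply: (@le_trans _ _ (\sum_(k < N) 1)); last by rewrite sumr_const card_ord.
by apply: ler_sum => k _; case/andP: (ind01 k x).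
Qed.

Lemma cutoff_in x : ccube R0 x -> cutoff x = 1.
Proof.
move=> xR; rewrite /cutoff (eq_bigr (fun=> 1)) => [|k _].
  by rewrite sumr_const card_ord mulVf// gt_eqF.
rewrite indicE mem_set//; move: xR; apply: ccubeS.
by have := r_le (leq0n k); rewrite /r expr0 mulr1.
Qed.

Lemma cutoff_out x : ~ ccube (r N) x -> cutoff x = 0.
Proof.
move=> xR; rewrite /cutoff big1 ?mulr0// => k _.
rewrite indicE memNset//; apply: contra_not xR; apply: ccubeS.
by apply: r_le; exact: ltnW.
Qed.

(** Let [p] be the least index with the cube inside [ccube (r p)], or [N] if that comes first.
    Indicators of index at least [p] are 1 on the cube, and off [S = ccube (r (p - 2))] those of
    index at most [p - 2] are 0. Only the index [p - 1] is undetermined, at the cost of [1 / N]. *)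
Lemma cutoff_osc a l : 0 < l -> exists th S,
  [/\ 0 <= th <= 1, measurable S, vol (S `&` hcube a l) <= tau * l ^+ n &
    forall x, hcube a l x -> ~ S x -> `|cutoff x - th| <= N%:R^-1].
Proof.
move=> l0.
have ex : exists p, `[< p = N \/ hcube a l `<=` ccube (r p) >].
  by exists N; apply/asboolP; left.
case: (ex_minnP ex) => p /asboolP pP pmin.
have lep (k : nat) : (k < p)%N -> ~ (hcube a l `<=` ccube (r k)).
  move=> kp S; have : (p <= k)%N by apply: pmin; apply/asboolP; right.
  by rewrite leqNgt kp.
have gep (k : nat) : (p <= k < N)%N -> hcube a l `<=` ccube (r k).
  move=> /andP[pk kN]; case: pP => [pN|S].
    by move: kN; rewrite -pN ltnNge pk.
  by apply: (subset_trans S); apply: ccubeS; exact: r_le.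
pose th : R := N%:R^-1 * \sum_(k < N) (p <= k)%N%:R.
pose S : set T := if p is q.+2 then ccube (r q) else set0.
exists th, S; split.
- apply/andP; split; first by rewrite mulr_ge0 ?invr_ge0 ?ler0n// sumr_ge0.
  rewrite /th mulrC ler_pdivrMr// mul1r.
  apply: (@le_trans _ _ (\sum_(k < N) 1)); last by rewrite sumr_const card_ord.
  by apply: ler_sum => k _; case: (_ <= _)%N.
- by rewrite /S; case: p {pP pmin lep gep th S} => [|[|q]] //; exact: measurable_ccube.
- rewrite /S; move: lep; case: p {pP pmin gep th S} => [|[|q]] lep.
  1,2: by rewrite set0I /vol measure0 mulr_ge0 ?exprn_ge0 ?ltW.
  have [SQ0|/set0P[x [xS xl]]] := eqVneq (ccube (r q) `&` hcube a l) set0.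
    by rewrite SQ0 /vol measure0 mulr_ge0 ?exprn_ge0 ?ltW.
  have [y [yl yB]] : exists y, hcube a l y /\ ~ ccube (r q.+1) y.
    apply: contrapT => /forallNP HH; apply: (lep q.+1 (ltnSn _)) => y yl.
    by apply: contrapT => yB; apply: (HH y).
  (* A cube that meets [ccube (r q)] and leaves [ccube (r q.+1)] is longer than the gap
     [2 * r q / tau] between the two radii. *)
  have ll : 2 * r q <= tau * l.
    have [i iB] : exists i, ~ (- r q.+1 <= (y : 'rV[R]_n) ord0 i < r q.+1).
      by apply/existsNP => HH; apply: yB; apply/ccubeE.
    have : 2 * r q / tau < l.
      have := (ccubeE (r q) x).1 xS i; have := xl i; have := yl i.
      move: iB; rewrite rS => iB yi xi ri.
      have [h|h] := lerP (- (r q + 2 * r q / tau)) ((y : 'rV[R]_n) ord0 i).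
        have : r q + 2 * r q / tau <= (y : 'rV[R]_n) ord0 i.
          by rewrite leNgt; apply/negP => h'; apply: iB; rewrite h h'.
        by lra.
      by lra.
    by rewrite ltr_pdivrMr//; lra.
  have rq0 : 0 < 2 * r q by rewrite mulr_gt0.
  apply: (@le_trans _ _ (vol (ccube (r q)))).
    apply: (vol_le (a := const_mx (- r q)) (l := 2 * r q)) => //.
    - apply: measurableI; [exact: measurable_ccube|exact: measurable_hcube].
    - exact: measurable_ccube.
  rewrite vol_hcube//.
  apply: (@le_trans _ _ ((tau * l) ^+ n)).
    by apply: lerXn2r; rewrite ?nnegrE//; [exact: ltW|exact/ltW/mulr_gt0].
  rewrite exprMn ler_wpM2r ?exprn_ge0 ?(ltW l0)//.
  by rewrite -[leRHS]expr1; apply: ler_wiXn2l => //; rewrite ltW.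
- move=> x xl Sx; rewrite /cutoff /th -mulrBr normrM ger0_norm ?invr_ge0//.
  rewrite -[leRHS]mulr1 ler_wpM2l ?invr_ge0// -sumrB.
  apply: (le_trans (ler_norm_sum _ _ _)).
  apply: (@le_trans _ _ (\sum_(k < N) (k.+1 == p)%:R)).
    apply: ler_sum => k _; rewrite indicE.
    have [pk|kp] := leqP p k.
      by rewrite mem_set ?subrr ?normr0//; apply: (gep k) xl; rewrite pk /=.
    have [kp1|kp1] := eqVneq k.+1 p.
      by rewrite subr0; case: (_ \in _); rewrite ?normr1 ?normr0.
    rewrite memNset ?subrr ?normr0//.
    move: Sx kp kp1; rewrite /S; case: p {pP pmin lep gep th S} => [//|[|q]].
      by case: k => -[|k] //=.
    move=> Sx; rewrite ltnS leq_eqVlt eqSS => /orP[->//|]; rewrite ltnS => kq _.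
    by apply: contra_not Sx; apply: ccubeS; exact: r_le.
  case: p {pP pmin lep gep th S Sx} => [|q].
    by rewrite big1// => k _; rewrite eqn0Ngt.
  have [qN|qN] := ltnP q N.
    rewrite (bigD1 (Ordinal qN))//= eqxx big1 ?addr0// => k /negbTE kq.
    by rewrite eqSS (_ : (k == q :> nat) = false).
  rewrite big1// => k _; rewrite eqSS (_ : (k == q :> nat) = false)//.
  by apply/negbTE; rewrite neq_ltn (leq_trans (ltn_ord k) qN).
Qed.

End cutoff.

End truncation.

(** * Smooth functions *)

Section flat_functions.
Context {R : realType}.
Implicit Types (p : {poly R}) (t s : R).

Lemma is_derive1_chain (f g : R -> R) (x df dg : R) :
  is_derive (g x) 1 f df -> is_derive x 1 g dg ->
  is_derive x 1 (f \o g) (df * dg).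
Proof.
move=> [f1 <-] [g1 <-]; apply: DeriveDef.
  move/derivable1_diffP: f1 => f1; move/derivable1_diffP: g1 => g1.
  exact/derivable1_diffP/(differentiable_comp g1 f1).
by rewrite -!derive1E (derive1_comp g1 f1).
Qed.

(* The class of functions [p(1/t) exp(-1/t)] is stable under derivation. *)
Definition flat p t : R := if 0 < t then p.[t^-1] * expR (- t^-1) else 0.

Lemma expR_decay m (y : R) : 0 < y -> expR (- y) <= m.+1`!%:R / y ^+ m.+1.
Proof.
move=> y0; have y1 : 0 < y ^+ m.+1 by rewrite exprn_gt0.
have f0 : 0 < m.+1`!%:R :> R by rewrite ltr0n fact_gt0.
rewrite expRN -invf_div lef_pV2 ?posrE ?expR_gt0 ?divr_gt0//.
by apply: le_trans (expR_ge1Dxn m (ltW y0)); rewrite lerDr.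
Qed.

(** Order two at the origin forces the derivative 0 there. For [t <= 1] the polynomial is at most a
    multiple of [t^-1 ^+ m], and the exponential is estimated with the power [m + 2] to leave
    [t ^+ 2]. *)
Lemma flat_small p : exists2 C, 0 <= C &
  forall t, 0 < t -> t <= 1 -> `|flat p t| <= C * t ^+ 2.
Proof.
pose m := size p; pose A := \sum_(i < m) `|p`_i|.
have A0 : 0 <= A by apply: sumr_ge0.
exists (A * m.+2`!%:R); first by rewrite mulr_ge0// ler0n.
move=> t t0 t1; have y1 : 1 <= t^-1 by rewrite invf_ge1.
have y0 : 0 < t^-1 by rewrite invr_gt0.
have hp : `|p.[t^-1]| <= A * t^-1 ^+ m.
  rewrite horner_coef mulr_suml; apply: (le_trans (ler_norm_sum _ _ _)).
  apply: ler_sum => i _; rewrite normrM ler_wpM2l//.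
  rewrite ger0_norm ?exprn_ge0 ?(ltW y0)//.
  by apply: ler_weXn2l => //; exact: ltnW.
rewrite /flat t0 normrM [`|expR _|]ger0_norm ?expR_ge0//.
apply: (@le_trans _ _ (A * t^-1 ^+ m * (m.+2`!%:R / t^-1 ^+ m.+2))).
  by apply: ler_pM; [exact: normr_ge0|exact: expR_ge0|exact: hp|exact: expR_decay].
rewrite le_eqVlt; apply/orP; left; apply/eqP.
rewrite -addn2 exprD; field.
by rewrite expf_neq0 ?invr_eq0 gt_eqF.
Qed.

(** The chain rule through [1/t] brings the factor [t ^- 2], which is ['X^2] at [1/t]; the
    exponential contributes [p], and the inner sign makes the derivative of [p] negative. *)
Definition dflat p : {poly R} := (p - p^`()) * 'X^2.

Lemma is_derive_flat p t : is_derive t 1 (flat p) (flat (dflat p) t).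
Proof.
have [t0|t0|t0] := ltrgtP t 0.
- rewrite /flat lt_gtF//; apply: near_eq_is_derive (is_derive_cst 0 t 1).
  near=> s; rewrite lt_gtF//; near: s; exact: lt_nbhsl.
- have iV : is_derive t 1 (fun s : R => s^-1) (- t ^- 2).
    have tn0 : (id t : R) != 0 by rewrite gt_eqF.
    apply: DeriveDef; first by apply: derivableV.
    by rewrite deriveV// derive_id scaler1.
  have d1 := is_derive1_chain (is_derive_poly p t^-1) iV.
  have iN : is_derive t 1 (fun s : R => - s^-1) (t ^- 2).
    by apply: is_derive_eq; rewrite opprK.
  have d2 := @is_derive1_chain expR (fun s => - s^-1) t _ _ (is_derive_expR _) iN.
  have d3 := is_deriveM d1 d2.
  rewrite [X in is_derive _ _ _ X](_ : _ = p.[t^-1] *: (expR (- t^-1) * t ^- 2) +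
      expR (- t^-1) *: (p^`().[t^-1] * - t ^- 2)).
    apply: near_eq_is_derive d3; near=> s.
    rewrite /flat ifT//=; near: s; exact: lt_nbhsr.
  by rewrite /flat t0 /dflat !hornerE /GRing.scale/=; field; rewrite gt_eqF.
- have [C C0 HC] := flat_small p.
  rewrite {2}/flat t0 ltxx.
  have L : (fun h : R => h^-1 *: ((flat p \o shift 0) (h *: 1) - flat p 0)) @ 0^' --> (0 : R).
    apply/cvgrPdist_le => e e0; near=> h.
    rewrite /= addr0 [h *: 1]mulr1 {2}/flat ltxx subr0 sub0r normrN.
    have h1 : `|h| <= 1 by near: h; exact: dnbhs0_le.
    have hC : `|h| <= e / (C + 1).
      by near: h; apply: dnbhs0_le; rewrite divr_gt0//; lra.
    have [h0|h0] := lerP h 0; first by rewrite /flat ltNge h0 scaler0 normr0 ltW.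
    have hh : `|h| = h by rewrite gtr0_norm.
    rewrite normrM normfV hh mulrC ler_pdivrMr//.
    rewrite hh in h1 hC; apply: (le_trans (HC h h0 h1)).
    rewrite expr2 mulrA ler_pM2r//.
    move: hC; rewrite ler_pdivlMr; last by lra.
    by nra.
  by apply: DeriveDef; [exact: cvgP L|exact: (cvg_lim _ L)].
Unshelve. all: by end_near. Qed.

Lemma flat_cont p : continuous (flat p).
Proof.
move=> t; apply/differentiable_continuous/derivable1_diffP.
by have [] := is_derive_flat p t.
Qed.

End flat_functions.

Lemma is_derive_along {R : realType} {V : normedModType R} (f : V -> R) (x v : V)
    (df : R) :
  is_derive (0 : R) 1 (fun h : R => f (h *: v + x)) df -> is_derive x v f df.
Proof.
move=> [d1 d2]; apply: DeriveDef; first by apply/derivable1P.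
rewrite -d2 /derive; set g1 := fun h => h^-1 *: _; set g2 := fun h => h^-1 *: _.
suff -> : g1 = g2 by [].
by rewrite funeqE /g1 /g2 => h /=; rewrite addr0 scale0r add0r [_%:A]mulr1.
Qed.

Section smooth_functions.
Context {R : realType} {n : nat}.
Implicit Types (u v : 'rV[R]_n -> R) (k : nat).

Lemma Ck_continuous k u : Ck k u -> continuous u.
Proof. by case: k => [|k] [cu _]. Qed.

Lemma Ck_le1 k u : Ck k.+1 u -> Ck k u.
Proof.
elim: k u => [|k IHk] u [cu H]; first by split.
by split=> // i; have [du Du] := H i; split => //; exact: IHk.
Qed.

Lemma Ck_cst k (c : R) : Ck k (fun _ : 'rV[R]_n => c).
Proof.
elim: k c => [|k IHk] c; first by split => //; apply: cst_continuous.
split=> [|i]; first by apply: cst_continuous.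
split=> [x|]; first exact: derivable_cst.
rewrite [X in Ck _ X](_ : _ = (fun=> 0)); first exact: IHk.
by apply/funext => x; exact: derive_cst.
Qed.

Lemma Ck_add k u v : Ck k u -> Ck k v -> Ck k (fun x => u x + v x).
Proof.
elim: k u v => [|k IHk] u v [cu Hu] [cv Hv].
  by split => // x; exact: (continuousD (cu x) (cv x)).
split=> [x|i]; first exact: (continuousD (cu x) (cv x)).
have [du Du] := Hu i; have [dv Dv] := Hv i.
split=> [x|]; first exact: (derivableD (du x) (dv x)).
rewrite [X in Ck _ X](_ : _ = (fun x => 'D_(delta_mx ord0 i) u x +
    'D_(delta_mx ord0 i) v x)); first exact: IHk.
by apply/funext => x; exact: (deriveD (du x) (dv x)).
Qed.

Lemma Ck_mul k u v : Ck k u -> Ck k v -> Ck k (fun x => u x * v x).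
Proof.
elim: k u v => [|k IHk] u v.
  by move=> [cu _] [cv _]; split => // x; exact: (continuousM (cu x) (cv x)).
move=> Cu Cv; have [cu Hu] := Cu; have [cv Hv] := Cv.
split=> [x|i]; first exact: (continuousM (cu x) (cv x)).
have [du Du] := Hu i; have [dv Dv] := Hv i.
split=> [x|]; first exact: (derivableM (du x) (dv x)).
rewrite [X in Ck _ X](_ : _ = (fun x => u x * 'D_(delta_mx ord0 i) v x +
    v x * 'D_(delta_mx ord0 i) u x)).
  by apply: Ck_add; apply: IHk => //; exact: Ck_le1.
by apply/funext => x; exact: (deriveM (du x) (dv x)).
Qed.

Lemma continuous_inv u : (forall x, u x != 0) -> continuous u ->
  continuous (fun x => (u x)^-1).
Proof.
move=> u0 cu x; have cux : u y @[y --> x] --> u x by exact: cu.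
exact: (cvgV (u0 x) cux).
Qed.

Lemma Ck_inv k u : (forall x, u x != 0) -> Ck k u -> Ck k (fun x => (u x)^-1).
Proof.
move=> u0; elim: k u u0 => [|k IHk] u u0 Cu.
  by split => //; exact: continuous_inv (Ck_continuous Cu).
have [cu Hu] := Cu.
split=> [|i]; first exact: continuous_inv.
have [du Du] := Hu i.
split=> [x|]; first exact: (derivableV (u0 x) (du x)).
rewrite [X in Ck _ X](_ : _ = (fun x => (-1 * ((u x)^-1 * (u x)^-1)) *
    'D_(delta_mx ord0 i) u x)).
  have Cv : Ck k (fun x => (u x)^-1) by apply: IHk => //; exact: Ck_le1.
  by apply: Ck_mul => //; apply: Ck_mul; [exact: Ck_cst|exact: Ck_mul].
apply/funext => x; rewrite (deriveV (u0 x) (du x)) /GRing.scale/=.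
by rewrite mulN1r -expr2 exprVn.
Qed.

Lemma Ck_sum k (I : Type) (s : seq I) (F : I -> 'rV[R]_n -> R) :
  (forall i, Ck k (F i)) -> Ck k (fun x => \sum_(i <- s) F i x).
Proof.
move=> HF; elim: s => [|i s IHs].
  rewrite [X in Ck _ X](_ : _ = (fun=> 0)); first exact: Ck_cst.
  by apply/funext => x; rewrite big_nil.
rewrite [X in Ck _ X](_ : _ = (fun x => F i x + \sum_(i <- s) F i x)).
  exact: Ck_add.
by apply/funext => x; rewrite big_cons.
Qed.

Lemma Ck_prod k (I : Type) (s : seq I) (F : I -> 'rV[R]_n -> R) :
  (forall i, Ck k (F i)) -> Ck k (fun x => \prod_(i <- s) F i x).
Proof.
move=> HF; elim: s => [|i s IHs].
  rewrite [X in Ck _ X](_ : _ = (fun=> 1)); first exact: Ck_cst.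
  by apply/funext => x; rewrite big_nil.
rewrite [X in Ck _ X](_ : _ = (fun x => F i x * \prod_(i <- s) F i x)).
  exact: Ck_mul.
by apply/funext => x; rewrite big_cons.
Qed.

(** The induction on [k] covers all polynomials at once, because a partial derivative replaces [p]
    by [dflat p] up to a constant factor. *)
Lemma Ck_flat k p (i : 'I_n) (al be : R) :
  Ck k (fun x : 'rV[R]_n => flat p (al * x ord0 i + be)).
Proof.
have cF q : continuous (fun x : 'rV[R]_n => flat q (al * x ord0 i + be)).
  move=> x.
  have cx : (y : 'rV[R]_n) ord0 i @[y --> x] --> x ord0 i by exact: coord_continuous.
  have h : al * (y : 'rV[R]_n) ord0 i + be @[y --> x] --> al * x ord0 i + be.
    exact: (cvgD (cvgM (cvg_cst al) cx) (cvg_cst be)).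
  have fc : {for al * x ord0 i + be, continuous (flat q)} by exact: flat_cont.
  exact: (continuous_cvg _ fc h).
have dF q (j : 'I_n) (x : 'rV[R]_n) : is_derive x (delta_mx ord0 j)
    (fun x : 'rV[R]_n => flat q (al * x ord0 i + be))
    (al * (i == j)%:R * flat (dflat q) (al * x ord0 i + be)).
  apply: is_derive_along.
  rewrite (_ : (fun h => _) = flat q \o (fun h => (al * (i == j)%:R) * h +
      (al * x ord0 i + be))); last first.
    apply/funext => h /=; rewrite !mxE eqxx /=; congr flat.
    by ring.
  have dg : is_derive (0 : R) 1 (fun h : R => (al * (i == j)%:R) * h +
      (al * x ord0 i + be)) (al * (i == j)%:R).
    have := is_deriveD (is_deriveZ (al * (i == j)%:R) (is_derive_id (0 : R) 1))
      (is_derive_cst (al * x ord0 i + be) (0 : R) 1).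
    by rewrite addr0 /GRing.scale/= mulr1.
  apply: is_derive_eq (is_derive1_chain (is_derive_flat q _) dg) _.
  by rewrite /= mulr0 add0r mulrC.
elim: k p => [|k IHk] p; first by split.
split=> // j; split=> [x|]; first by have [] := dF p j x.
rewrite [X in Ck _ X](_ : _ = (fun x : 'rV[R]_n =>
    (al * (i == j)%:R) * flat (dflat p) (al * x ord0 i + be))).
  by apply: Ck_mul => //; exact: Ck_cst.
by apply/funext => x; have [] := dF p j x.
Qed.

End smooth_functions.

Section smooth_step.
Context {R : realType}.
Implicit Types (t s : R).

(** Smooth transition from 0 to 1 over the unit interval; the denominator is positive because [t]
    and [1 - t] are never both nonpositive. *)
Definition sstep t : R := flat 1 t / (flat 1 t + flat 1 (1 - t)).

Lemma flat1E t : 0 < t -> flat 1 t = expR (- t^-1).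
Proof. by move=> t0; rewrite /flat t0 hornerE mul1r. Qed.

Lemma flat1_le0 (p : {poly R}) t : t <= 0 -> flat p t = 0.
Proof. by move=> t0; rewrite /flat ltNge t0. Qed.

Lemma flat1_ge0 t : 0 <= flat 1 t.
Proof.
have [t0|t0] := lerP t 0; first by rewrite flat1_le0.
by rewrite flat1E// expR_ge0.
Qed.

Lemma flat1_mono t s : t <= s -> flat 1 t <= flat 1 s.
Proof.
move=> ts; have [t0|t0] := lerP t 0; first by rewrite flat1_le0// flat1_ge0.
have s0 := lt_le_trans t0 ts.
by rewrite !flat1E// ler_expR lerN2 lef_pV2.
Qed.

Lemma sstep_den t : 0 < flat 1 t + flat 1 (1 - t).
Proof.
have [t0|t0] := lerP t 0.
  by rewrite (flat1_le0 _ t0) add0r flat1E ?expR_gt0//; lra.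
by rewrite ltr_pwDl ?flat1_ge0// flat1E// expR_gt0.
Qed.

Lemma sstep0 t : t <= 0 -> sstep t = 0.
Proof. by move=> t0; rewrite /sstep flat1_le0// mul0r. Qed.

Lemma sstep1 t : 1 <= t -> sstep t = 1.
Proof.
move=> t1; have := sstep_den t; rewrite /sstep [flat 1 (1 - t)]flat1_le0; last by lra.
by rewrite addr0 => d; rewrite divff// gt_eqF.
Qed.

Lemma sstep_mono t s : t <= s -> sstep t <= sstep s.
Proof.
move=> ts; rewrite /sstep ler_pdivrMr ?sstep_den// mulrAC ler_pdivlMr ?sstep_den//.
have h1 := flat1_mono ts.
have h2 : flat 1 (1 - s) <= flat 1 (1 - t) by apply: flat1_mono; lra.
have := flat1_ge0 t; have := flat1_ge0 (1 - s) => *.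
have : flat 1 t * flat 1 (1 - s) <= flat 1 s * flat 1 (1 - t) by exact: ler_pM.
by lra.
Qed.

Lemma sstep_ge0 t : 0 <= sstep t.
Proof. by rewrite divr_ge0 ?flat1_ge0// ltW// sstep_den. Qed.

Lemma sstep_le1 t : sstep t <= 1.
Proof.
by rewrite /sstep ler_pdivrMr ?sstep_den// mul1r lerDl flat1_ge0.
Qed.

(** As a difference of translates of the step, it has integer translates whose sum telescopes, so
    the partition of unity needs no normalisation. *)
Definition bump t : R := sstep (t + 1) - sstep t.

Lemma bump_ge0 t : 0 <= bump t.
Proof. by rewrite subr_ge0; apply: sstep_mono; lra. Qed.

Lemma bump_out t : 1 <= `|t| -> bump t = 0.
Proof.
rewrite /bump ler_normr => /orP[h|h]; first by rewrite !sstep1 ?subrr//; lra.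
by rewrite !sstep0 ?subrr//; lra.
Qed.

Lemma bump_sum t (K : nat) :
  \sum_(j < K.*2.+1) bump (t - (j%:R - K%:R)) =
  sstep (t + K%:R + 1) - sstep (t - K%:R).
Proof.
rewrite -(big_mkord xpredT (fun j => bump (t - (j%:R - K%:R)))).
pose f (j : nat) := - sstep (t + K%:R + 1 - j%:R).
rewrite (eq_bigr (fun j => f j.+1 - f j)); last first.
  move=> j _; rewrite /bump /f -natr1.
  have -> : t + K%:R + 1 - (j%:R + 1) = t - (j%:R - K%:R) by ring.
  have -> : t + K%:R + 1 - j%:R = t - (j%:R - K%:R) + 1 by ring.
  by ring.
rewrite telescope_sumr// /f subr0 opprK addrC; congr (_ - sstep _).
by rewrite -addn1 natrD -muln2 natrM; ring.
Qed.

End smooth_step.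

Section continuous_measurable.
Context {R : realType} {n : nat}.
Local Notation T := (lebesgueType R n).

(** [g] is the pointwise limit of functions constant on the half-open grid cubes of mesh [2 ^- N],
    which are countably many. *)
Lemma measurable_continuous_rV (g : 'rV[R]_n -> R) : continuous g ->
  measurable_fun [set: T] (g : T -> R).
Proof.
move=> cg.
pose w (N : nat) : R := 2 ^- N.
have w0 N : 0 < w N by rewrite invr_gt0 exprn_gt0.
pose pt (N : nat) (j : {ffun 'I_n -> int}) : 'rV[R]_n := \row_i (w N * (j i)%:~R).
pose fl (N : nat) (x : 'rV[R]_n) : {ffun 'I_n -> int} :=
  [ffun i => Num.floor (x ord0 i / w N)].
have flP N x j : hcube (pt N j) (w N) x <-> fl N x = j.
  split=> [h|<- i].
    apply/ffunP => i; rewrite ffunE; apply: floor_def.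
    have := h i; rewrite mxE ler_pdivlMr// ltr_pdivrMr// rmorphD/=.
    by rewrite (mulrC _ (w N)) (mulrC _ (w N)) mulrDr mulr1.
  rewrite mxE ffunE; have := floor_itv (x ord0 i / w N).
  rewrite ler_pdivlMr// ltr_pdivrMr// rmorphD/=.
  by rewrite (mulrC _ (w N)) (mulrC _ (w N)) mulrDr mulr1.
apply: (@measurable_fun_cvg _ T R setT
  (fun (N : nat) (x : T) => g (pt N (fl N x))) g).
  move=> N _ Y mY; rewrite setTI.
  pose F j := if `[< Y (g (pt N j)) >] then hcube (pt N j) (w N) else set0.
  rewrite (_ : _ @^-1` Y = \bigcup_j F j).
    apply: countable_bigcupT_measurable => // j.
    by rewrite /F; case: ifP => // _; exact: measurable_hcube.
  apply/seteqP; split => x /=.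
    by move=> Yx; exists (fl N x) => //; rewrite /F asboolT//; exact/flP.
  by move=> [j _]; rewrite /F; case: asboolP => // Yj /flP ->.
move=> x _; have cgx : {for x, continuous g} by exact: cg.
apply: (continuous_cvg _ cgx).
apply/cvg_ballP => e e0.
have [N0 wN0] : exists N, w N < e.
  have e20 : 0 < e / 2 by rewrite divr_gt0.
  have [N hN] := exists_half 1 e20.
  by exists N; apply: (le_lt_trans (y := e / 2)); [rewrite /w -[2 ^- N]mul1r|lra].
exists N0 => // N /= NN.
have wN : w N < e.
  apply: le_lt_trans wN0; rewrite /w lef_pV2 ?posrE ?exprn_gt0//.
  by rewrite ler_weXn2l// ler1n.
split => // i j; rewrite /ball/=.
have := (flP N x _).2 erefl j; rewrite !mxE (ord1 i) => h.
by rewrite ger0_norm; lra.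
Qed.

End continuous_measurable.

(** * Smooth partition of unity subordinate to a finite grid *)

Section partition_of_unity.
Context {R : realType} {n : nat}.
Local Notation T := (lebesgueType R n).
Variables (s : R) (K : nat).
Hypothesis s0 : 0 < s.
Local Notation J := {ffun 'I_n -> 'I_K.*2.+1}.
Implicit Types (x : 'rV[R]_n) (j : J).

Definition grid (i : 'I_K.*2.+1) : R := i%:R - K%:R.

Definition punit j x : R := \prod_i bump (x ord0 i / s - grid (j i)).

Lemma punit_ge0 j x : 0 <= punit j x.
Proof. by apply: prodr_ge0 => i _; exact: bump_ge0. Qed.

Lemma punit_near j x i : punit j x != 0 ->
  s * grid (j i) - s < x ord0 i < s * grid (j i) + s.
Proof.
move=> /prodf_neq0/(_ i isT) b0.
have : `|x ord0 i / s - grid (j i)| < 1.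
  by rewrite ltNge; apply: contra b0 => /bump_out ->.
rewrite ltr_norml => /andP[h1 h2].
have E : x ord0 i = s * (x ord0 i / s) by field; rewrite gt_eqF.
have h3 : s * (grid (j i) - 1) < s * (x ord0 i / s) by rewrite ltr_pM2l//; lra.
have h4 : s * (x ord0 i / s) < s * (grid (j i) + 1) by rewrite ltr_pM2l//; lra.
by lra.
Qed.

Lemma sum_punitE x : \sum_j punit j x =
  \prod_i (sstep (x ord0 i / s + K%:R + 1) - sstep (x ord0 i / s - K%:R)).
Proof.
rewrite /punit -(bigA_distr_bigA (fun i k => bump (x ord0 i / s - grid k))).
by apply: eq_bigr => i _; exact: bump_sum.
Qed.

Lemma sum_punit_le1 x : \sum_j punit j x <= 1.
Proof.
rewrite sum_punitE; apply: prodr_ile1 => i _.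
have h : x ord0 i / s - K%:R <= x ord0 i / s + K%:R + 1.
  by have := ler0n R K; lra.
have := sstep_le1 (x ord0 i / s + K%:R + 1); have := sstep_ge0 (x ord0 i / s - K%:R).
by have := sstep_mono h; lra.
Qed.

Lemma sum_punit1 x : (forall i, `|x ord0 i| <= s * K%:R) ->
  \sum_j punit j x = 1.
Proof.
move=> xK; rewrite sum_punitE big1// => i _.
have : `|x ord0 i / s| <= K%:R.
  by rewrite normf_div (gtr0_norm s0) ler_pdivrMr// mulrC.
rewrite ler_norml => /andP[h1 h2].
by rewrite sstep1 ?sstep0 ?subr0//; lra.
Qed.

Lemma Ck_sstep k (i : 'I_n) (al be : R) :
  Ck k (fun x : 'rV[R]_n => sstep (al * x ord0 i + be)).
Proof.
rewrite [X in Ck _ X](_ : _ = (fun x : 'rV[R]_n => flat 1 (al * x ord0 i + be) *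
   (flat 1 (al * x ord0 i + be) + flat 1 (- al * x ord0 i + (1 - be)))^-1)); last first.
  apply/funext => x; rewrite /sstep; congr (_ / (_ + flat 1 _)); ring.
apply: Ck_mul; first exact: Ck_flat.
apply: Ck_inv => [x|]; last by apply: Ck_add; exact: Ck_flat.
rewrite gt_eqF//; have := sstep_den (al * x ord0 i + be).
by congr (_ < _ + flat 1 _); ring.
Qed.

Lemma Ck_punit k j : Ck k (punit j).
Proof.
apply: Ck_prod => i.
rewrite [X in Ck _ X](_ : _ = (fun x : 'rV[R]_n =>
    sstep (s^-1 * x ord0 i + (1 - grid (j i))) +
    (-1) * sstep (s^-1 * x ord0 i + - grid (j i)))); last first.
  apply/funext => x; rewrite /bump mulN1r; congr (sstep _ - sstep _); ring.
apply: Ck_add; first exact: Ck_sstep.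
by apply: Ck_mul; [exact: Ck_cst|exact: Ck_sstep].
Qed.

End partition_of_unity.

Section smoothing.
Context {R : realType} {n : nat}.
Local Notation T := (lebesgueType R n).
Local Notation mu := (@lebesgue_rV R n).
Implicit Types (a b : 'rV[R]_n) (l c d e lam : R) (h u : T -> R) (E : set T).

(** For one fixed value, goodness of all children gives goodness of the cube, and repeated halving
    brings any larger side into the range from [s / 2] to [s]. *)
Lemma good_halving lam e h (s : R) : measurable_fun setT h -> 0 < s ->
  (forall a l, s / 2 <= l -> l <= s -> good lam e h a l 0) ->
  forall a l, s / 2 <= l -> good lam e h a l 0.
Proof.
move=> mh s0 H a l sl.
have [N lN] : exists N, l / 2 ^+ N <= s by exact: exists_half.
elim: N a l sl lN => [|N IHN] a l sl lN.
  by apply: H => //; move: lN; rewrite expr0 divr1.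
have [ls|sl'] := lerP l s; first exact: H.
have l0 : 0 < l by lra.
rewrite /good (vol_additive _ (measurable_dev _ _ mh) l0).
apply: (@le_trans _ _ (\sum_(e : {ffun 'I_n -> bool}) lam * (l / 2) ^+ n)).
  apply: ler_sum => e' _; apply: IHN; first by lra.
  rewrite (_ : l / 2 / 2 ^+ N = l / 2 ^+ N.+1)//.
  by rewrite exprS invfM mulrA.
rewrite sumr_const card_ffun card_bool card_ord -[leLHS]mulr_natr.
rewrite natrX -mulrA -exprMn divfK// pnatr_eq0.
Qed.

(** [g] blends good values of [u] on grid cubes of mesh [s]. Cubes of side below [s / 2] get a
    constant of their own; on the others [u - g] itself is small, first for sides up to [s], then
    for all sides by halving. All chains stay in cubes of side at most [dl], the only ones where [u]
    is known to have good values. *)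
Lemma smoothing lam : 0 <= lam -> lam < 2^-1 ->
  exists2 C : R, 0 <= C & forall u e dl r0, measurable_fun setT u -> 0 <= e ->
    0 < dl -> (forall a l, 0 < l -> l <= dl -> exists c, good lam e u a l c) ->
    (forall x, ~ ccube r0 x -> u x = 0) ->
    exists g : 'rV[R]_n -> R, [/\ forall k, Ck k g,
      exists r, forall x, ~ ccube r x -> g x = 0 &
      forall a l, 0 < l -> exists c, good lam (C * e) (fun x => u x - g x) a l c].
Proof.
(* The largest ratio of sides met in a chain: the reference cube has side [dl = 8 * s], and it is
   compared with cubes of side as small as [s / 2]. *)
move=> lam0 lam2; have h16 : (1 : R) <= 16 by lra.
have [C1 C10 chain] := @good_chain R n lam 16 lam0 lam2 h16.
exists (2 * C1 + 3) => [|u e dl r0 mu_ e0 dl0 HG u0]; first by lra.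
pose s := dl / 8; have s0 : 0 < s by rewrite /s; lra.
have [K sK] : exists K : nat, r0 + dl <= s * K%:R.
  exists (Num.bound `|(r0 + dl) / s|).
  rewrite mulrC -ler_pdivrMr//; apply: (le_trans (ler_norm _)).
  by apply/ltW/archi_boundP.
have [cc Hcc] : {cc : 'rV[R]_n * R -> R &
    forall p, 0 < p.2 -> p.2 <= dl -> good lam e u p.1 p.2 (cc p)}.
  apply: (@boolp.choice _ _ (fun p c => 0 < p.2 -> p.2 <= dl ->
    good lam e u p.1 p.2 c)) => -[a l].
  have [l0|_] := ltrP 0 l; last by exists 0.
  have [ll|_] := lerP l dl; last by exists 0.
  by have [c gc] := HG a l l0 ll; exists c.
have {}Hcc a l : 0 < l -> l <= dl -> good lam e u a l (cc (a, l)).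
  by move=> l0 ll; exact: (Hcc (a, l)).
pose J := {ffun 'I_n -> 'I_K.*2.+1}.
pose corner (j : J) : 'rV[R]_n := \row_i (s * (grid (j i) : R)).
pose g (x : 'rV[R]_n) := \sum_(j : J) cc (corner j, s) * punit s j x.
have Cg k : Ck k g.
  by apply: Ck_sum => j; apply: Ck_mul; [exact: Ck_cst|exact: Ck_punit].
have mg : measurable_fun setT (g : T -> R).
  exact/measurable_continuous_rV/(Ck_continuous (Cg 0)).
have mug : measurable_fun setT (fun x : T => u x - g x) by exact: measurable_funB.
(* With side [dl], this reference cube contains [hcube a l] for [l <= s] and every grid cube whose
   bump is nonzero at a point of it, as the corners of those are between [a - s] and [a + 2 * s]. *)
pose big a : 'rV[R]_n := \row_i (a ord0 i - 2 * s).
have s8 : 8 * s = dl by rewrite /s; lra.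
have gnear a l x : 0 < l -> l <= s -> hcube a l x ->
    `|g x - cc (big a, dl)| <= (C1 + 2) * e.
  move=> l0 ls xl; set c := cc (big a, dl).
  have hj j : punit s j x != 0 -> `|cc (corner j, s) - c| <= C1 * e.
    move=> pj; apply: (chain u e dl (corner j) s _ (big a) dl _) => //.
    - by lra.
    - move=> i; rewrite !mxE; have := punit_near s0 i pj; have := xl i.
      by lra.
    - by lra.
    - by apply: Hcc => //; lra.
    - exact: Hcc.
  have h1 : `|\sum_(j : J) (cc (corner j, s) - c) * punit s j x| <= C1 * e.
    apply: (le_trans (ler_norm_sum _ _ _)).
    apply: (@le_trans _ _ (\sum_(j : J) C1 * e * punit s j x)).
      apply: ler_sum => j _; rewrite normrM (ger0_norm (punit_ge0 _ _ _)).
      have [->|pj] := eqVneq (punit s j x) 0; first by rewrite !mulr0.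
      by rewrite ler_wpM2r ?punit_ge0//; exact: hj.
    rewrite -mulr_sumr -[leRHS]mulr1 ler_wpM2l ?mulr_ge0//.
    exact: sum_punit_le1.
  have gE : g x - c = \sum_(j : J) (cc (corner j, s) - c) * punit s j x +
      c * (\sum_(j : J) punit s j x - 1).
    rewrite mulrBr mulr1 mulr_sumr addrA -big_split/=; congr (_ - _).
    by apply: eq_bigr => j _; rewrite -mulrDl subrK.
  (* Either the partition sums to 1 at [x], or [x] is so far out that [u] vanishes on the whole
     reference cube; then [c] is within [2 * e] of 0, which bounds the effect of the missing
     mass. *)
  have [xK|/existsNP[i /negP]] := pselect (forall i, `|(x : 'rV[R]_n) ord0 i| <= s * K%:R).
    rewrite gE sum_punit1// subrr mulr0 addr0; apply: (le_trans h1).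
    by lra.
  rewrite -ltNge => xi.
  have c2 : `|c| <= 2 * e.
    have g1 : good lam e u (big a) dl c by exact: Hcc.
    have g2 : good lam e u (big a) dl 0.
      rewrite /good (_ : dev u 0 e `&` _ = set0).
        by rewrite /vol measure0 mulr_ge0// exprn_ge0// ltW.
      rewrite -subset0 => y [dy yb]; move: dy; rewrite /dev /= u0.
        by rewrite subr0 normr0 ltNge e0.
      move=> /ccubeE/(_ i) yr; have := yb i; rewrite mxE; have := xl i.
      move: xi; rewrite lter_normr => /orP[]; lra.
    have := good_close mu_ dl0 dl0 (@subset_refl _ _) _ g1 g2.
    rewrite subr0; apply; have : 0 < dl ^+ n by rewrite exprn_gt0.
    by nra.
  rewrite gE; apply: (le_trans (ler_normD _ _)).
  have : `|c * (\sum_(j : J) punit s j x - 1)| <= 2 * e.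
    rewrite normrM -[leRHS]mulr1; apply: ler_pM => //.
    have := sum_punit_le1 s K x.
    have : 0 <= \sum_(j : J) punit s j x by apply: sumr_ge0 => j _; exact: punit_ge0.
    by move=> *; rewrite ler_norml; lra.
  by lra.
exists g; split=> //.
- exists (s * K%:R + s) => x xr; rewrite /g big1// => j _.
  have [->|pj] := eqVneq (punit s j x) 0; first by rewrite mulr0.
  exfalso; apply: xr; apply/ccubeE => i; have := punit_near s0 i pj.
  have : - K%:R <= (grid (j i) : R) <= K%:R.
    have : ((j i)%:R : R) <= K%:R + K%:R by rewrite -natrD ler_nat addnn -ltnS.
    by rewrite /grid; have := ler0n R (j i); lra.
  move=> /andP[k1 k2].
  have : s * - K%:R <= s * (grid (j i) : R) by rewrite ler_pM2l.
  have : s * (grid (j i) : R) <= s * K%:R by rewrite ler_pM2l.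
  lra.
- have eC : (C1 + 2) * e + e <= (2 * C1 + 3) * e by nra.
  move=> a l l0; have [ls|sl] := ltrP l (s / 2).
    have gl : good lam e u a l (cc (a, l)) by apply: Hcc => //; lra.
    exists (cc (a, l) - cc (big a, dl)).
    apply: good_transfer0 gl => // x xl h.
    have ls' : l <= s by lra.
    have := gnear a l x l0 ls' xl.
    rewrite (_ : u x - g x - _ = (u x - cc (a, l)) - (g x - cc (big a, dl))); last by ring.
    by move=> h'; apply: (le_trans (ler_normB _ _)); lra.
  exists 0; apply: (good_halving (s := s)) sl => // a' l1 sl1 ls1.
  have l10 : 0 < l1 by lra.
  have gl : good lam e u a' l1 (cc (a', l1)) by apply: Hcc => //; lra.
  have d1 : `|cc (a', l1) - cc (big a', dl)| <= C1 * e.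
    apply: (chain u e dl a' l1 _ (big a') dl _) => //.
    - by lra.
    - by move=> i; rewrite mxE; lra.
    - by lra.
    - exact: Hcc.
  apply: good_transfer0 gl => // x xl h.
  have := gnear a' l1 x l10 ls1 xl.
  rewrite subr0 (_ : u x - g x = (u x - cc (a', l1)) +
    ((cc (a', l1) - cc (big a', dl)) - (g x - cc (big a', dl)))); last by ring.
  move=> h'; apply: (le_trans (ler_normD _ _)).
  have := ler_normB (cc (a', l1) - cc (big a', dl)) (g x - cc (big a', dl)).
  by lra.
Qed.

End smoothing.

Lemma ge0_integral_le_add d (T : measurableType d) (R : realType)
    (mu : {measure set T -> \bar R}) (f g h : T -> R) (A : set T) :
  measurable A -> measurable_fun setT f -> measurable_fun setT g ->
  measurable_fun setT h ->
  (forall x, 0 <= f x) -> (forall x, 0 <= g x) -> (forall x, 0 <= h x) ->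
  (forall x, A x -> f x <= g x + h x) ->
  (\int[mu]_(x in A) (f x)%:E <=
   \int[mu]_(x in A) (g x)%:E + \int[mu]_(x in A) (h x)%:E)%E.
Proof.
move=> mA mf mg mh f0 g0 h0 fgh.
have mE (k : T -> R) : measurable_fun setT k -> measurable_fun A (EFin \o k).
  by move=> mk; apply/measurable_EFinP; exact: measurable_funTS.
have kE (k : T -> R) x : (forall x, 0 <= k x) -> A x -> (0 <= (k x)%:E)%E.
  by move=> k0 _; rewrite lee_fin.
rewrite -(ge0_integralD mu mA (fun x => kE g x g0) (mE g mg)
  (fun x => kE h x h0) (mE h mh)).
exact: (ge0_integral_le mu mA mf (measurable_funD mg mh) f0 fgh).
Qed.

(** * Approximation by smooth functions with compact support *)

Section approximation.
Context {R : realType} {n : nat}.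
Local Notation T := (lebesgueType R n).
Local Notation mu := (@lebesgue_rV R n).
Implicit Types (a b : 'rV[R]_n) (l c d e lam : R) (h u : T -> R) (E : set T).
Hypothesis n0 : (0 < n)%N.

Lemma clamp_vanishing lam M h : 0 <= M -> measurable_fun setT h ->
  vanishing_osc lam h -> vanishing_osc lam (fun x => clamp M (h x)).
Proof.
move=> M0 mh H e /H[dl [L [d [dl0 L0 d0 HG]]]]; exists dl, L, d; split => // a l l0.
move=> /(HG a l l0)[c g]; exists (clamp M c).
apply: (good_transfer0 mh (measurable_clamp M mh) l0 _ g) => x _.
by apply: le_trans; exact: clamp_lip.
Qed.

(** In [eta h - th c = eta (h - c) + c (eta - th)] the first term is controlled by [h], the second
    by [M / N] off a set of fraction [tau]. The difference [h - eta h] is good on every cube because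
    it vanishes on the non-extreme ones, whereas [eta h] is only claimed to be good on small
    cubes. *)
Lemma cutoff_approximation lam tau e M h : 0 < lam -> 0 < tau -> tau <= 1 -> 0
  < e -> 0 < M ->
  measurable_fun setT h -> (forall x, `|h x| <= M) -> vanishing_osc lam h ->
  exists eta : T -> R, [/\ measurable_fun setT eta,
    exists r, forall x, ~ ccube r x -> eta x = 0,
    forall a l, 0 < l -> exists c, good (lam + tau) e (fun x => h x - eta x * h x) a l c &
    exists2 dl, 0 < dl & forall a l, 0 < l -> l <= dl ->
      exists c, good (lam + tau) e (fun x => eta x * h x) a l c].
Proof.
move=> lam0 tau0 tau1 e0 M0 mh hM H.
have e20 : 0 < e / 2 by lra.
have [dl [L [d [dl0 L0 d0 HG]]]] := H _ e20.
pose N := (Num.bound `|M / (e / 2)|).+1.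
have N0 : (0 < N)%N by [].
have NR : (0 : R) < N%:R by rewrite ltr0n.
have MN : M * N%:R^-1 <= e / 2.
  rewrite ler_pdivrMr// mulrC -ler_pdivrMr//; apply: (le_trans (ler_norm _)).
  by apply/ltW/(lt_le_trans (archi_boundP _)) => //; rewrite ler_nat.
pose R0 := d + L; have R00 : 0 < R0 by rewrite addr_gt0.
have [eta etaE] : exists eta, eta = @cutoff R n R0 tau N by eexists.
have meta : measurable_fun setT eta by rewrite etaE; exact: measurable_cutoff.
have eta01 x : 0 <= eta x <= 1 by rewrite etaE; exact: cutoff01.
have m1 : measurable_fun setT (fun x => eta x * h x) by exact: measurable_funM.
have m2 : measurable_fun setT (fun x => h x - eta x * h x) by exact: measurable_funB.
have step a l c : 0 < l -> good lam (e / 2) h a l c ->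
    (exists c, good (lam + tau) e (fun x => h x - eta x * h x) a l c) /\
    (exists c, good (lam + tau) e (fun x => eta x * h x) a l c).
  move=> l0 g.
  (* Clamping leaves [h] unchanged and is 1-Lipschitz, so the value stays good while becoming at
     most [M] in modulus. *)
  have g' : good lam (e / 2) h a l (clamp M c).
    apply: good_transfer0 g => // x _; apply: le_trans.
    by rewrite -{1}(clamp_id (hM x)); apply: clamp_lip; exact: ltW.
  have cM : `|clamp M c| <= M by apply: clamp_norm; exact: ltW.
  have [th [S [th01 mS volS]]] := cutoff_osc R00 tau0 tau1 N0 n0 a l0.
  rewrite -etaE => HS.
  have ce x : hcube a l x -> ~ S x -> `|clamp M c| * `|eta x - th| <= e / 2.
    move=> xl Sx; apply: le_trans MN; apply: ler_pM => //; exact: HS.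
  split.
    exists ((1 - th) * clamp M c); apply: good_transfer g' => // x xl Sx hx.
    have -> : h x - eta x * h x - (1 - th) * clamp M c =
        (1 - eta x) * (h x - clamp M c) - clamp M c * (eta x - th) by ring.
    apply: (le_trans (ler_normB _ _)); rewrite !normrM.
    have : `|1 - eta x| * `|h x - clamp M c| <= 1 * (e / 2).
      apply: ler_pM => //; have /andP[? ?] := eta01 x.
      by rewrite ler_norml; apply/andP; split; lra.
    have := ce x xl Sx; lra.
  exists (th * clamp M c); apply: good_transfer g' => // x xl Sx hx.
  have -> : eta x * h x - th * clamp M c =
      eta x * (h x - clamp M c) + clamp M c * (eta x - th) by ring.
  apply: (le_trans (ler_normD _ _)); rewrite !normrM.
  have : `|eta x| * `|h x - clamp M c| <= 1 * (e / 2).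
    apply: ler_pM => //; have /andP[? ?] := eta01 x.
      by rewrite ler_norml; apply/andP; split; lra.
  have := ce x xl Sx; lra.
exists eta; split => //.
- by eexists => x; rewrite etaE; exact: cutoff_out.
- move=> a l l0.
  have [/(HG a l l0)[c /(step a l c l0)[]]//|/not_extreme[_ _ S]] :=
    pselect (extreme_cube dl L d a l).
  exists 0; rewrite /good (_ : dev _ _ _ `&` _ = set0).
    by rewrite /vol measure0 mulr_ge0 ?exprn_ge0 ?(ltW l0)// addr_ge0 ?ltW.
  rewrite -subset0 => x [+ xl]; rewrite /dev /= etaE cutoff_in//; last exact: S.
  by rewrite mul1r subrr subr0 normr0 ltNge ltW.
- exists dl => // a l l0 ll.
  by have [c /(step a l c l0)[]] := HG a l l0 (Or31 _ _ ll).
Qed.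

Lemma smooth_approximation lam e h : 0 < lam -> lam < 2^-1 -> 0 < e ->
  measurable_fun setT h ->
  (forall a l, 0 < l -> (\int[mu]_(x in hcube a l) (`|h x|)%:E < +oo)%E) ->
  vanishing_osc lam h ->
  exists g : 'rV[R]_n -> R, [/\ forall k, Ck k g,
    exists r, forall x, ~ ccube r x -> g x = 0 &
    forall a l, 0 < l -> exists c,
      (\int[mu]_(x in hcube a l) (`|h x - g x - c|)%:E <= (e * l ^+ n)%:E)%E].
Proof.
move=> lam0 lam2 e0 mh hloc H.
(* Half of the gap below 1/2 is spent on the cutoff; the other half keeps [lam1 < 1/2] for
   [john_stromberg] and [smoothing]. *)
pose tau := (2^-1 - lam) / 2; pose lam1 := lam + tau.
have tau0 : 0 < tau by rewrite /tau; lra.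
have tau1 : tau <= 1 by rewrite /tau; lra.
have lamlam1 : lam <= lam1 by rewrite /lam1; lra.
have lam10 : 0 <= lam1 by rewrite /lam1; lra.
have lam12 : lam1 < 2^-1 by rewrite /lam1 /tau; lra.
have [C C0 JS] := @john_stromberg R n lam1 lam10 lam12.
have [C2 C20 SM] := @smoothing R n lam1 lam10 lam12.
(* The pieces [h - h1], [h1 - u] and [u - g] cost [C * e1], [C * e1] and [C * (C2 * e1)]; the
   summand 1 in [C + 1] keeps the divisor positive when [C] is 0. *)
pose e1 := e / ((C + 1) * (C2 + 2)).
have D0 : 0 < (C + 1) * (C2 + 2) by rewrite mulr_gt0//; lra.
have e10 : 0 < e1 by rewrite divr_gt0.
have Ce1 : C * e1 + (C * e1 + C * (C2 * e1)) <= e.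
  have E : e1 * ((C + 1) * (C2 + 2)) = e by rewrite /e1 divfK// gt_eqF.
  have : 0 <= e1 * (C2 + 2) by rewrite mulr_ge0 ?(ltW e10)//; lra.
  by rewrite -E; lra.
have [M M0 H1] := truncation lam0 mh hloc H e10.
have H1' a l : 0 < l -> exists c, good lam1 e1 (fun x => h x - clamp M (h x)) a l c.
  move=> l0; have [c g] := H1 a l l0; exists c.
  exact: (good_mono (measurable_funB mh (measurable_clamp M mh)) l0 lamlam1 _ g).
pose h1 x := clamp M (h x).
have mh1 : measurable_fun setT h1 by exact: measurable_clamp.
have h1M x : `|h1 x| <= M by apply: clamp_norm; exact: ltW.
have Hh1 : vanishing_osc lam h1 by apply: clamp_vanishing => //; exact: ltW.
have [eta [meta [r etar] H2 [dl dl0 H3]]] :=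
  cutoff_approximation lam0 tau0 tau1 e10 M0 mh1 h1M Hh1.
pose u x := eta x * h1 x.
have mu_ : measurable_fun setT u by exact: measurable_funM.
have u0 x : ~ ccube r x -> u x = 0 by move=> /etar; rewrite /u => ->; rewrite mul0r.
have [g [Cg g0 H4]] := SM u e1 dl r mu_ (ltW e10) dl0 H3 u0.
exists g; split => // a l l0.
have mg : measurable_fun setT (g : T -> R).
  exact/measurable_continuous_rV/(Ck_continuous (Cg 0)).
have mv1 := measurable_funB mh mh1.
have mv2 := measurable_funB mh1 mu_.
have mv3 := measurable_funB mu_ mg.
have mv := measurable_funB mh mg.
have C2e : 0 <= C2 * e1 by rewrite mulr_ge0// ltW.
have [c1 /(JS _ e1 mv1 (ltW e10) H1' a l _ l0) J1] := H1' a l l0.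
have [c2 /(JS _ e1 mv2 (ltW e10) H2 a l _ l0) J2] := H2 a l l0.
have [c3 /(JS _ _ mv3 C2e H4 a l _ l0) J3] := H4 a l l0.
exists (c1 + c2 + c3).
have mQ := measurable_hcube a l.
have m1 := measurable_absB c1 mv1.
have m2 := measurable_absB c2 mv2.
have m3 := measurable_absB c3 mv3.
have m23 := measurable_funD m2 m3.
have m0 := measurable_absB (c1 + c2 + c3) mv.
have I1 := @ge0_integral_le_add _ _ _ mu _ _ _ _ mQ m0 m1 m23.
have I2 := @ge0_integral_le_add _ _ _ mu _ _ _ _ mQ m23 m2 m3.
apply: le_trans (I1 _ _ _ _) _ => //.
- by move=> x /=; rewrite addr_ge0.
- move=> x _ /=.
  have -> : h x - g x - (c1 + c2 + c3) =
    (h x - h1 x - c1) + ((h1 x - u x - c2) + (u x - g x - c3)) by ring.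
  by apply: (le_trans (ler_normD _ _)); rewrite lerD2l; exact: ler_normD.
apply: (le_trans (leeD J1 (le_trans (I2 _ _ _ _) (leeD J2 J3)))) => //.
  by move=> x /=; rewrite addr_ge0.
by rewrite -!EFinD lee_fin -!mulrDl ler_wpM2r ?exprn_ge0 ?(ltW l0).
Qed.

End approximation.

(** * Sufficiency *)

Section complex_modulus.
Context {R : realType}.
Implicit Types z w : R[i].

Lemma normc_ge0 z : 0 <= Normc.normc z.
Proof. by case: z => x y; exact: sqrtr_ge0. Qed.

Lemma Re_le_normc z : `|complex.Re z| <= Normc.normc z.
Proof.
by case: z => x y /=; rewrite -sqrtr_sqr ler_wsqrtr// lerDl sqr_ge0.
Qed.

Lemma Im_le_normc z : `|complex.Im z| <= Normc.normc z.
Proof.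
by case: z => x y /=; rewrite -sqrtr_sqr ler_wsqrtr// lerDr sqr_ge0.
Qed.

Lemma normc_le z : Normc.normc z <= `|complex.Re z| + `|complex.Im z|.
Proof.
case: z => x y /=; rewrite -[leRHS]ger0_norm ?addr_ge0// -sqrtr_sqr.
rewrite ler_wsqrtr// sqrrD !real_normK ?num_real// -addrA lerD2l lerDr.
by rewrite mulrn_wge0// mulr_ge0.
Qed.

Lemma ReB z w : complex.Re (z - w) = complex.Re z - complex.Re w.
Proof. by case: z; case: w. Qed.

Lemma ImB z w : complex.Im (z - w) = complex.Im z - complex.Im w.
Proof. by case: z; case: w. Qed.

End complex_modulus.

(** * From closed cubes and complex oscillations to half-open cubes and real values *)

Section closed_cubes.
Context {R : realType} {n : nat}.
Local Notation T := (lebesgueType R n).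
Local Notation mu := (@lebesgue_rV R n).
Implicit Types (a b : 'rV[R]_n) (l d e lam r : R) (f : 'rV[R]_n -> R[i]).

Definition qcube a l : set 'rV[R]_n :=
  [set x | forall i, a ord0 i <= x ord0 i <= a ord0 i + l].

Lemma is_cube_qcube a l : 0 < l -> is_cube (qcube a l).
Proof. by move=> l0; exists a, l. Qed.

Lemma mu_qcube a l : 0 < l -> mu (qcube a l) = (l ^+ n)%:E.
Proof. exact: lebesgue_cube. Qed.

Lemma qcubeE a l : qcube a l =
  [set x : 'rV[R]_n | forall i, `[a ord0 i, a ord0 i + l]%classic (x ord0 i)].
Proof. by apply/seteqP; split => x /= h i; have := h i; rewrite in_itv. Qed.

Lemma compact_qcube a l : compact (qcube a l).
Proof.
rewrite qcubeE.
apply: (@rV_compact _ _ (fun i => `[a ord0 i, a ord0 i + l]%classic)) => i.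
exact: segment_compact.
Qed.

Lemma measurable_qcube a l : measurable (qcube a l : set T).
Proof.
apply: borel_lebesgueW; rewrite qcubeE.
by apply: (measurable_box (I := fun i => `[a ord0 i, a ord0 i + l]%classic)).
Qed.

Lemma hcube_sub_qcube a l : hcube a l `<=` qcube a l.
Proof. by move=> x h i; have := h i; lra. Qed.

Lemma qcube_sub_hcube a l : 0 < l -> qcube a l `<=` hcube a (2 * l).
Proof. by move=> l0 x h i; have := h i; lra. Qed.

Lemma le_lebesgue_rV (A B : set T) : A `<=` B -> (mu A <= mu B)%E.
Proof.
exact: (@le_mu_ext _ 'rV[R]_n R (borel_lebesgue n) A B).
Qed.

(** [p] stands for the real or the imaginary part. Both infima being below [e], some constant and
    some level below [e] realise the bound, and the half-open cube sits inside the closed one. *)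
Lemma osc_good lam f (p : R[i] -> R) e a l :
  (forall z, `|p z| <= Normc.normc z) ->
  (forall z w, p (z - w) = p z - p w) ->
  measurable_fun [set: T] (fun x => p (f x)) -> 0 < l ->
  (local_mean_osc lam f (qcube a l) < e%:E)%E ->
  exists c, good lam e (fun x : T => p (f x)) a l c.
Proof.
move=> pn pB mp l0 /ereal_inf_lt[_ [c _ <-]].
move=> /ereal_inf_lt[_ [al [al0 lt] <-]]; rewrite lte_fin => ale.
exists (p c); rewrite /good -lee_fin.
have md := measurable_dev (p c) e mp.
rewrite -(volE (measurableI _ _ md (measurable_hcube a l)) (@subIsetr _ _ _) l0).
move: lt; rewrite mu_qcube//= => /ltW; apply: le_trans.
apply: le_lebesgue_rV => x [dx xl] /=.
rewrite indicE mem_set ?mulr1; last exact: hcube_sub_qcube.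
by apply: (lt_trans ale); apply: lt_le_trans (pn _); rewrite pB.
Qed.

Lemma vanishing_osc_part lam f (p : R[i] -> R) : (0 < n)%N ->
  (forall z, `|p z| <= Normc.normc z) ->
  (forall z w, p (z - w) = p z - p w) ->
  measurable_fun [set: T] (fun x => p (f x)) ->
  ereal_sup [set local_mean_osc lam f Q | Q in
    [set Q | is_cube Q /\ mu Q = r%:E]] @[r --> 0^'+] --> 0%:E ->
  ereal_sup [set local_mean_osc lam f Q | Q in
    [set Q | is_cube Q /\ mu Q = r%:E]] @[r --> +oo] --> 0%:E ->
  ereal_sup [set local_mean_osc lam f Q | Q in
    [set Q | is_cube Q /\ Q `&` centered_cube d = set0]] @[d --> +oo] --> 0%:E ->
  vanishing_osc lam (fun x : T => p (f x)).
Proof.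
move=> n0 pn pB mp c1 c2 c3 e e0.
have nearlt (F : set_system R) (G : R -> \bar R) : Filter F ->
    G r @[r --> F] --> 0%:E -> \forall r \near F, (G r < e%:E)%E.
  move=> FF /fine_cvgP[Gfin /cvgr_lt/(_ _ e0) Glt].
  near=> r; rewrite -(fineK (_ : G r \is a fin_num)); last by near: r.
  by rewrite lte_fin; near: r.
have sup_lt (S : set (set 'rV[R]_n)) a l : 0 < l -> S (qcube a l) ->
    (ereal_sup [set local_mean_osc lam f Q | Q in S] < e%:E)%E ->
    exists c, good lam e (fun x : T => p (f x)) a l c.
  move=> l0 Sa lt; apply: osc_good => //; apply: le_lt_trans lt.
  by apply: ereal_sup_ubound; exists (qcube a l).
have [d1 d10 H1] := nearlt _ _ _ c1.
have [A2 [_ H2]] := nearlt _ _ _ c2.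
have [A3 [_ H3]] := nearlt _ _ _ c3.
(* The limits concern volumes. With [dl <= 1 < L], small sides satisfy [l ^+ n <= l] and large ones
   [l <= l ^+ n], so bounds on the side suffice. *)
pose dl := Num.min 1 d1 / 2; pose L := Num.max 1 A2 + 1.
have min0 : 0 < Num.min 1 d1 by rewrite lt_min ltr01.
have dl1 : dl <= 1.
  have : Num.min 1 d1 <= 1 by rewrite ge_min lexx.
  by rewrite /dl; lra.
have dld : dl < d1.
  have : Num.min 1 d1 <= d1 by rewrite ge_min lexx orbT.
  by rewrite /dl; lra.
have L1 : 1 < L.
  have : 1 <= Num.max 1 A2 by rewrite le_max lexx.
  by rewrite /L; lra.
have LA : A2 < L.
  have : A2 <= Num.max 1 A2 by rewrite le_max lexx orbT.
  by rewrite /L; lra.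
have [d [d1' dA]] : exists d, 1 < d /\ A3 < d.
  exists (Num.max 1 A3 + 1).
  have : 1 <= Num.max 1 A3 by rewrite le_max lexx.
  have : A3 <= Num.max 1 A3 by rewrite le_max lexx orbT.
  by move=> *; split; lra.
exists dl, L, (d + 1); split.
- by rewrite divr_gt0.
- by apply: lt_trans L1.
- lra.
move=> a l l0 [ldl|Ll|ld].
- apply: (sup_lt [set Q | is_cube Q /\ mu Q = (l ^+ n)%:E]) => //.
    by split; [exact: is_cube_qcube|exact: mu_qcube].
  apply: H1; last by rewrite exprn_gt0.
  rewrite /= sub0r normrN ger0_norm ?exprn_ge0 ?(ltW l0)//.
  apply: (@le_lt_trans _ _ l); last by apply: le_lt_trans dld.
  rewrite -[leRHS]expr1; apply: ler_wiXn2l; [exact: ltW| |exact: n0].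
  exact: le_trans ldl dl1.
- apply: (sup_lt [set Q | is_cube Q /\ mu Q = (l ^+ n)%:E]) => //.
    by split; [exact: is_cube_qcube|exact: mu_qcube].
  apply: H2; apply: (lt_le_trans LA); apply: (le_trans Ll).
  rewrite -[leLHS]expr1; apply: ler_weXn2l => //.
  by apply: le_trans Ll; exact: ltW.
- apply: (sup_lt [set Q | is_cube Q /\ Q `&` centered_cube d = set0]) => //.
    split; first exact: is_cube_qcube.
    rewrite -subset0 => x [xa xd].
    have [t [t0 tl t2]] : exists t, [/\ 0 < t, t <= l / 2 & t <= 2^-1].
      exists (Num.min (l / 2) 2^-1); split; last 2 first.
      - by rewrite ge_min lexx.
      - by rewrite ge_min lexx orbT.
      by rewrite lt_min; apply/andP; split; lra.
    pose y : 'rV[R]_n := \row_i Num.max (a ord0 i) (x ord0 i - t).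
    suff : (hcube a l `&` ccube (d + 1)) y by rewrite ld.
    split=> [i|]; last apply/ccubeE => i; rewrite /= mxE;
      have /andP[? ?] := xa i; have /andP[? ?] := xd i; case: (leP (a ord0 i) (x ord0 i - t)) => h;
      apply/andP; split; lra.
  exact: H3.
Unshelve. all: by end_near. Qed.

End closed_cubes.

Section mean_oscillation.
Context d (T : measurableType d) (R : realType) (mu : {measure set T -> \bar R}).
Implicit Types (v : T -> R) (A : set T).

(** The mean differs from [c] by at most the mean of [|v - c|], hence the factor 2. *)
Lemma integral_sub_mean_le v A (q c B : R) : measurable A -> 0 < q ->
  mu A = q%:E -> measurable_fun setT v ->
  (\int[mu]_(x in A) (`|v x - c|)%:E <= B%:E)%E ->
  (\int[mu]_(x in A) (`|v x - (\int[mu]_(y in A) v y) / q|)%:E <= (2 * B)%:E)%E.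
Proof.
move=> mA q0 muA mv leB.
have mvc := measurable_funB mv (measurable_cst c).
have mabs r : measurable_fun setT (fun x => `|v x - r|).
  have mN : measurable_fun [set: R] (@Num.norm _ R) by exact: normr_measurable.
  exact: (measurableT_comp mN (measurable_funB mv (measurable_cst r))).
have ivc : mu.-integrable A (EFin \o (v \- cst c)).
  apply/integrableP; split.
    by apply/measurable_EFinP; exact: measurable_funTS.
  by apply: le_lt_trans leB _; rewrite ltry.
have ic : mu.-integrable A (EFin \o cst c).
  apply/integrableP; split.
    by apply/measurable_EFinP; exact: measurable_cst.
  rewrite (_ : (\int[mu]_(x in A) _ = \int[mu]_(x in A) cst `|c|%:E x)%E)//.
  by rewrite integral_cst// muA -EFinM ltry.
have Ev : \int[mu]_(y in A) v y = \int[mu]_(y in A) (v y - c) + c * q.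
  rewrite -[in RHS](_ : fine (mu A) = q); last by rewrite muA.
  rewrite -(Rintegral_cst mu mA c) -(RintegralD mA ivc ic).
  by apply: eq_Rintegral => x _ /=; rewrite subrK.
have B0 : 0 <= B.
  rewrite -lee_fin; apply: le_trans leB.
  by apply: integral_ge0 => x _; rewrite lee_fin.
have mc : `|c - (\int[mu]_(y in A) v y) / q| <= B / q.
  rewrite Ev mulrDl mulfK ?gt_eqF// opprD addrCA subrr addr0 normrN normf_div.
  rewrite (gtr0_norm q0) ler_pM2r ?invr_gt0//.
  apply: (le_trans (le_normr_Rintegral mA ivc)).
  rewrite -lee_fin /Rintegral fineK//.
  rewrite ge0_fin_numE; first by apply: le_lt_trans leB _; rewrite ltry.
  by apply: integral_ge0 => x _; rewrite lee_fin.
have Bq0 : 0 <= B / q by rewrite divr_ge0// ltW.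
have := ge0_integral_leD mu mA (mabs ((\int[mu]_(y in A) v y) / q)) (mabs c)
  (fun x => normr_ge0 _) (fun x => normr_ge0 _) Bq0.
move=> /(_ _)/le_trans; apply.
  move=> x _; rewrite -[X in `|X|](_ : (v x - c) +
    (c - (\int[mu]_(y in A) v y) / q) = _); last by ring.
  by apply: (le_trans (ler_normD _ _)); rewrite lerD2l.
rewrite muA -EFinM divfK ?gt_eqF// (_ : 2 * B = B + B); last by ring.
by rewrite EFinD leeD2r.
Qed.

End mean_oscillation.

Section sufficiency.
Context {R : realType} {n : nat}.
Local Notation T := (lebesgueType R n).
Local Notation mu := (@lebesgue_rV R n).
Implicit Types (a b : 'rV[R]_n) (l e lam r : R) (f g w : 'rV[R]_n -> R[i]).

Lemma measurable_normc w : mfun_complex w ->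
  measurable_fun [set: T] (fun x => Normc.normc (w x)).
Proof.
move=> [m1 m2].
rewrite (_ : (fun x => _) = (fun x : T =>
  Num.sqrt (complex.Re (w x) ^+ 2 + complex.Im (w x) ^+ 2))); last first.
  by apply/funext => x; case: (w x).
have ms : measurable_fun [set: R] (@Num.sqrt R).
  by apply: continuous_measurable_fun; exact: sqrt_continuous.
have m3 := measurable_funD (measurable_funM m1 m1) (measurable_funM m2 m2).
exact: (measurableT_comp ms m3).
Qed.

Lemma L1loc_part f (p : R[i] -> R) a l : L1loc f ->
  (forall z, `|p z| <= Normc.normc z) ->
  measurable_fun [set: T] (fun x => p (f x)) -> 0 < l ->
  (\int[mu]_(x in hcube a l) (`|p (f x)|)%:E < +oo)%E.
Proof.
move=> [mf fK] pn mp l0; have fQ := fK _ (compact_qcube (a := a) (l := l)).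
apply: (le_lt_trans _ fQ).
have mN := measurable_normc mf.
have mA : measurable_fun setT (fun x : T => `|p (f x)|).
  have mN' : measurable_fun [set: R] (@Num.norm _ R) by exact: normr_measurable.
  exact: (measurableT_comp mN' mp).
have mH := measurable_hcube a l; have mQ := measurable_qcube a l.
apply: (@le_trans _ _ (\int[mu]_(x in hcube a l) (Normc.normc (f x))%:E)%E).
  exact: (ge0_integral_le mu mH mA mN (fun x => normr_ge0 _) (fun x _ => pn _)).
have mE : measurable_fun (qcube a l : set T) (EFin \o (fun x => Normc.normc (f x))).
  by apply/measurable_EFinP; exact: measurable_funTS.
have E0 (x : T) : (qcube a l : set T) x -> (0 <= (EFin \o (fun x => Normc.normc (f x))) x)%E.
  by move=> _; rewrite lee_fin normc_ge0.
exact: (ge0_subset_integral mu mH mQ mE E0 (@hcube_sub_qcube _ _ a l)).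
Qed.

(** The constant 4 is a factor 2 for centring at the mean times 2 for adding real and imaginary
    parts. *)
Lemma BMO_norm_le w e : mfun_complex w ->
  (forall a l, 0 < l -> exists c,
    (\int[mu]_(x in qcube a l) (`|complex.Re (w x) - c|)%:E <= (e * l ^+ n)%:E)%E) ->
  (forall a l, 0 < l -> exists c,
    (\int[mu]_(x in qcube a l) (`|complex.Im (w x) - c|)%:E <= (e * l ^+ n)%:E)%E) ->
  (BMO_norm w <= (4 * e)%:E)%E.
Proof.
move=> mw H1 H2; have [m1 m2] := mw.
apply: ge_ereal_sup => _ [Q [a [l [l0 QE]]] <-].
have {QE} -> : Q = qcube a l by [].
have mQ := measurable_qcube a l; have muQ := mu_qcube a l0.
have q0 : 0 < l ^+ n by rewrite exprn_gt0.
have [c1 /(integral_sub_mean_le mQ q0 muQ m1) J1] := H1 a l l0.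
have [c2 /(integral_sub_mean_le mQ q0 muQ m2) J2] := H2 a l l0.
set c := cmean w (qcube a l).
have cRe : complex.Re c = (\int[mu]_(x in qcube a l) complex.Re (w x)) / l ^+ n.
  by rewrite /c /cmean muQ.
have cIm : complex.Im c = (\int[mu]_(x in qcube a l) complex.Im (w x)) / l ^+ n.
  by rewrite /c /cmean muQ.
rewrite -cRe in J1; rewrite -cIm in J2.
have mwc : mfun_complex (fun x => w x - c).
  split.
    rewrite (_ : (fun x => _) = (fun x : T => complex.Re (w x) - complex.Re c)).
      exact: (measurable_funB m1 (measurable_cst _)).
    by apply/funext => x; rewrite ReB.
  rewrite (_ : (fun x => _) = (fun x : T => complex.Im (w x) - complex.Im c)).
    exact: (measurable_funB m2 (measurable_cst _)).
  by apply/funext => x; rewrite ImB.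
have mN := measurable_normc mwc.
have mA := measurable_absB (complex.Re c) m1.
have mB := measurable_absB (complex.Im c) m2.
have I := ge0_integral_le_add mu mQ mN mA mB (fun x => normc_ge0 _)
  (fun x => normr_ge0 _) (fun x => normr_ge0 _).
rewrite muQ/= -lee_pdivlMl ?invr_gt0//.
apply: le_trans (I _) _.
  by move=> x _; rewrite -ReB -ImB; exact: normc_le.
apply: (le_trans (leeD J1 J2)); rewrite -EFinD invrK -EFinM lee_fin.
by lra.
Qed.

End sufficiency.

Section sufficiency.
Context {R : realType} {n : nat}.
Local Notation T := (lebesgueType R n).
Local Notation mu := (@lebesgue_rV R n).
Implicit Types (a b : 'rV[R]_n) (l e lam r : R) (f g w : 'rV[R]_n -> R[i]).

Lemma Ccinfty_parts (gr gi : 'rV[R]_n -> R) :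
  (forall k, Ck k gr) -> (forall k, Ck k gi) ->
  (exists r, forall x : T, ~ ccube r x -> gr x = 0) ->
  (exists r, forall x : T, ~ ccube r x -> gi x = 0) ->
  Ccinfty (fun x => gr x +i* gi x).
Proof.
move=> Cr Ci [r1 H1] [r2 H2]; split; first by move=> k; split; [exact: Cr|exact: Ci].
pose r := Num.max r1 r2; pose Q := qcube (const_mx (- r) : 'rV[R]_n) (2 * r).
have cQ : compact Q by exact: compact_qcube.
have clQ : closed Q by apply: compact_closed => //; exact: norm_hausdorff.
apply: (subclosed_compact _ cQ); first exact: closed_closure.
rewrite [X in _ `<=` X](closure_id Q).1//; apply: closureS => x /= gx.
apply: hcube_sub_qcube; apply: contrapT => xr; move: gx.
have r1r : r1 <= r by rewrite le_max lexx.
have r2r : r2 <= r by rewrite le_max lexx orbT.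
rewrite H1 ?H2 ?eqxx//; apply: contra_not xr.
  exact: (ccubeS r2r).
exact: (ccubeS r1r).
Qed.

Lemma vanishing_osc_CMO lam f : (0 < n)%N -> 0 < lam -> lam < 2^-1 -> BMO f ->
  vanishing_osc lam (fun x : T => complex.Re (f x)) ->
  vanishing_osc lam (fun x : T => complex.Im (f x)) -> CMO f.
Proof.
move=> n0 lam0 lam2 fBMO H1 H2; split => // e e0.
have [fL _] := fBMO; have [[m1 m2] _] := fL.
(* [2 ^+ n] pays for enclosing a closed cube of side [l] in a half-open one of side [2 * l], and the
   factor 4 of [BMO_norm_le] turns [e / 8] into [e / 2]. *)
pose e1 := e / 8 / 2 ^+ n.
have e10 : 0 < e1 by rewrite !divr_gt0// exprn_gt0.
have E1 : e1 * 2 ^+ n = e / 8 by rewrite /e1 divfK// expf_neq0.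
have L1 a l : 0 < l -> _ := L1loc_part a fL (@Re_le_normc R) m1.
have L2 a l : 0 < l -> _ := L1loc_part a fL (@Im_le_normc R) m2.
have [gr [Cr r0 G1]] := smooth_approximation n0 lam0 lam2 e10 m1 L1 H1.
have [gi [Ci i0 G2]] := smooth_approximation n0 lam0 lam2 e10 m2 L2 H2.
exists (fun x => gr x +i* gi x); first exact: Ccinfty_parts.
have mgr : measurable_fun setT (gr : T -> R).
  exact/measurable_continuous_rV/(Ck_continuous (Cr 0)).
have mgi : measurable_fun setT (gi : T -> R).
  exact/measurable_continuous_rV/(Ck_continuous (Ci 0)).
have hq (v : T -> R) : measurable_fun setT v ->
    (forall a l, 0 < l -> exists c,
      (\int[mu]_(x in hcube a l) (`|v x - c|)%:E <= (e1 * l ^+ n)%:E)%E) ->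
    forall a l, 0 < l -> exists c,
      (\int[mu]_(x in qcube a l) (`|v x - c|)%:E <= (e / 8 * l ^+ n)%:E)%E.
  move=> mv H a l l0; have l20 : 0 < 2 * l by rewrite mulr_gt0.
  have [c Hc] := H a (2 * l) l20; exists c.
  rewrite -E1 -mulrA -exprMn; apply: le_trans Hc.
  have mE : measurable_fun (hcube a (2 * l)) (EFin \o (fun x => `|v x - c|)).
    by apply/measurable_EFinP; apply: measurable_funTS; exact: measurable_absB.
  have E0 (x : T) : hcube a (2 * l) x -> (0 <= (`|v x - c|%R)%:E)%E.
    by move=> _; rewrite lee_fin.
  exact: (ge0_subset_integral mu (measurable_qcube a l)
    (measurable_hcube a (2 * l)) mE E0 (qcube_sub_hcube l0)).
have mR := measurable_funB m1 mgr; have mI := measurable_funB m2 mgi.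
have RE : (fun x : T => complex.Re (f x - (gr x +i* gi x))) =
    (fun x : T => complex.Re (f x)) \- gr by apply/funext => x; rewrite ReB.
have IE : (fun x : T => complex.Im (f x - (gr x +i* gi x))) =
    (fun x : T => complex.Im (f x)) \- gi by apply/funext => x; rewrite ImB.
apply: (@le_lt_trans _ _ (4 * (e / 8))%:E); last by rewrite lte_fin; lra.
apply: BMO_norm_le.
- by split; rewrite ?RE ?IE.
- move=> a l l0; have [c Hc] := hq _ mR G1 a l l0; exists c.
  by under eq_integral do rewrite ReB.
- move=> a l l0; have [c Hc] := hq _ mI G2 a l l0; exists c.
  by under eq_integral do rewrite ImB.
Qed.

End sufficiency.

(** * Necessity *)

Section necessity.
Context {R : realType} {n : nat}.
Local Notation T := (lebesgueType R n).
Local Notation mu := (@lebesgue_rV R n).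
Implicit Types (a b : 'rV[R]_n) (l e lam r al : R) (f g w : 'rV[R]_n -> R[i]).

Lemma coord_le_norm (v : 'rV[R]_n) i : `|v ord0 i| <= `|v|.
Proof.
rewrite [leRHS]/Num.norm /= mx_normrE; apply/bigmax_geP; right => /=.
by exists (ord0, i).
Qed.

Lemma compact_support_bound (u : 'rV[R]_n -> R[i]) :
  compact (closure [set x | u x != 0]) ->
  exists2 r, 0 < r & forall x, ~ qcube (const_mx (- r)) (2 * r) x -> u x = 0.
Proof.
move=> /compact_bounded[M [_ HM]]; exists (`|M| + 1); first by rewrite ltr_wpDl.
move=> x xr; apply/eqP/negPn/negP => ux; apply: xr => i.
have /(HM (`|M| + 1)) : closure [set x | u x != 0] x by exact: subset_closure.
have M1 : M < `|M| + 1 by rewrite (le_lt_trans (ler_norm M))// ltrDl.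
move=> /(_ M1)/(le_trans (coord_le_norm x i)).
by rewrite ler_norml mxE; lra.
Qed.

(** Compactness of the cube, in its near-covering form, makes the local radii uniform for points of
    the cube; for a pair with neither point in it, both values are 0. *)
Lemma compact_support_unif (u : 'rV[R]_n -> R) a l al : continuous u ->
  (forall x, ~ qcube a l x -> u x = 0) -> 0 < al ->
  exists2 del : R, 0 < del & forall x y : 'rV[R]_n, (forall i, `|x ord0 i - y ord0 i| <= del) ->
    `|u x - u y| <= al.
Proof.
move=> cu u0 al0.
have : near_covering (qcube a l) by apply/compact_near_coveringP/compact_qcube.
move=> /(_ R (0 : R)^'+ (fun (del : R) (x : 'rV[R]_n) => forall y : 'rV[R]_n,
  (forall i, `|x ord0 i - y ord0 i| <= del) -> `|u x - u y| <= al) _).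
case.
  move=> x _; have al20 : 0 < al / 2 by rewrite divr_gt0.
  have /cvgrPdist_le/(_ _ al20) : u y @[y --> x] --> u x by exact: cu.
  move=> /nbhs_ballP[rho /= rho0 Hrho].
  have rho20 : 0 < rho / 2 by rewrite divr_gt0.
  exists (ball x (rho / 2), [set del | del < rho / 2]).
    by split; [exact: nbhsx_ballx|exact: nbhs_right_lt].
  move=> [x' del] [/= xx' ldel] y xy.
  have h1 : `|u x - u x'| <= al / 2.
    by apply: Hrho; apply: le_ball xx'; lra.
  have h2 : `|u x - u y| <= al / 2.
    apply: Hrho; split=> // i j; rewrite (ord1 i).
    have := xx'.2 ord0 j; rewrite /ball/= => h.
    have -> : x ord0 j - y ord0 j = (x ord0 j - x' ord0 j) + (x' ord0 j - y ord0 j) by ring.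
    by apply: (le_lt_trans (ler_normD _ _)); have := xy j; lra.
  have -> : u x' - u y = (u x - u y) - (u x - u x') by ring.
  by apply: (le_trans (ler_normB _ _)); lra.
move=> del /= del0 H; exists (del / 2); first by rewrite divr_gt0.
have {}H (x y : 'rV[R]_n) : qcube a l x -> (forall i, `|x ord0 i - y ord0 i| <= del / 2) ->
    `|u x - u y| <= al.
  move=> xa xy; apply: (H (del / 2) _ _ x xa y xy).
    by rewrite /= sub0r normrN gtr0_norm; lra.
  by rewrite divr_gt0.
move=> x y xy; have [xa|xa] := pselect (qcube a l x); first exact: H.
have [ya|ya] := pselect (qcube a l y).
  by rewrite distrC; apply: H => // i; rewrite distrC.
by rewrite (u0 _ xa) (u0 _ ya) subrr normr0 ltW.
Qed.

Lemma chebyshev_mean w e al a l : mfun_complex w -> 0 < al -> 0 < l ->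
  (BMO_norm w < e%:E)%E ->
  (mu ([set x : T | (al < Normc.normc (w x - cmean w (qcube a l)))%R] `&` qcube a l) <=
   (e / al * l ^+ n)%:E)%E.
Proof.
move=> mw al0 l0 we; have [m1 m2] := mw.
set c := cmean w (qcube a l).
have mwc : mfun_complex (fun x => w x - c).
  split.
    rewrite (_ : (fun x => _) = (fun x : T => complex.Re (w x) - complex.Re c)).
      exact: (measurable_funB m1 (measurable_cst _)).
    by apply/funext => x; rewrite ReB.
  rewrite (_ : (fun x => _) = (fun x : T => complex.Im (w x) - complex.Im c)).
    exact: (measurable_funB m2 (measurable_cst _)).
  by apply/funext => x; rewrite ImB.
have mN := measurable_normc mwc; have mQ := measurable_qcube a l.
have ln0 : 0 < l ^+ n by rewrite exprn_gt0.
have := markov_abs mu mQ mN al0.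
have nn x : `|Normc.normc (w x - c)| = Normc.normc (w x - c).
  by rewrite ger0_norm// normc_ge0.
under eq_integral do rewrite nn.
rewrite [X in (_ * mu (X `&` _))%E](_ : _ = [set x : T | al < Normc.normc (w x - c)]); last first.
  by apply/seteqP; split => x /=; rewrite nn.
have : (\int[mu]_(x in qcube a l) (Normc.normc (w x - c))%:E <= (e * l ^+ n)%:E)%E.
  rewrite mulrC EFinM -lee_pdivrMl//.
  apply: le_trans (ltW we); apply: ereal_sup_ubound.
  by exists (qcube a l); [exact: is_cube_qcube|rewrite mu_qcube].
move=> + h => /(le_trans h).
by rewrite -lee_pdivlMl// -EFinM mulrA (mulrC al^-1).
Qed.

Lemma local_mean_osc_le lam f c al a l (E : set T) : 0 < al -> 0 < l ->
  (forall x, qcube a l x -> al < Normc.normc (f x - c) -> E x) ->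
  (mu E < (lam * l ^+ n)%:E)%E ->
  (local_mean_osc lam f (qcube a l) <= al%:E)%E.
Proof.
move=> al0 l0 H lE.
apply: (@le_trans _ _ (rearrangement (fun x => (f x - c) * \1_(qcube a l) x)
    (lam * fine (mu (qcube a l))))).
  by apply: ereal_inf_lbound; exists c.
apply: ereal_inf_lbound; exists al => //; split => //.
rewrite mu_qcube//=; apply: le_lt_trans lE; apply: le_lebesgue_rV => x /=.
rewrite indicE; have [xa|xa] := pselect (qcube a l x).
  by rewrite mem_set// mulr1; exact: H.
by rewrite memNset// mulr0 Normc.normc0 ltNge ltW.
Qed.

Lemma local_mean_osc_ge0 lam f Q : (0 <= local_mean_osc lam f Q)%E.
Proof.
apply: le_ereal_inf_tmp => _ [c _ <-]; apply: le_ereal_inf_tmp => _ [al [al0 _] <-].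
by rewrite lee_fin ltW.
Qed.

Lemma CMO_small_osc lam f al : 0 < lam -> CMO f -> 0 < al ->
  exists r, 0 < r /\ exists L d, forall a l, 0 < l ->
    [\/ l <= r, L <= l ^+ n | qcube a l `&` centered_cube d = set0] ->
    (local_mean_osc lam f (qcube a l) <= al%:E)%E.
Proof.
move=> lam0 [[[mf _] _] fC] al0.
pose al2 := al / 2; have al20 : 0 < al2 by rewrite divr_gt0.
(* At height [al2] Chebyshev's inequality then leaves at most the fraction [lam / 2] of a cube. The
   other half of [lam] is kept for the support of [g] in large cubes, the other half of [al] for the
   variation of [g] on small ones. *)
have e0 : 0 < lam / 2 * al2 by rewrite !mulr_gt0// invr_gt0.
have [g [gS gK] ge] := fC _ e0.
have [rho rho0 grho] := compact_support_bound gK.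
have gR := Ck_continuous (gS 0%N).1; have gI := Ck_continuous (gS 0%N).2.
have mw : mfun_complex (fun x => f x - g x).
  have [m1 m2] := mf; split.
    rewrite (_ : (fun x => _) = (fun x : T => complex.Re (f x) - complex.Re (g x))).
      exact: (measurable_funB m1 (measurable_continuous_rV gR)).
    by apply/funext => x; rewrite ReB.
  rewrite (_ : (fun x => _) = (fun x : T => complex.Im (f x) - complex.Im (g x))).
    exact: (measurable_funB m2 (measurable_continuous_rV gI)).
  by apply/funext => x; rewrite ImB.
have Ch a l : 0 < l -> (mu ([set x : T | (al2 < Normc.normc (f x - g x -
    cmean (fun x => f x - g x) (qcube a l)))%R] `&` qcube a l) <=
    (lam / 2 * l ^+ n)%:E)%E.
  move=> l0; have := chebyshev_mean a mw al20 l0 ge.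
  by rewrite -(mulrA (lam / 2)) divff ?mulr1// gt_eqF.
have lt2 l : 0 < l -> ((lam / 2 * l ^+ n)%:E < (lam * l ^+ n)%:E)%E.
  by move=> l0; rewrite lte_fin ltr_pM2r ?exprn_gt0//; lra.
have al40 : 0 < al2 / 2 by rewrite divr_gt0.
have gR0 x : ~ qcube (const_mx (- rho)) (2 * rho) x -> complex.Re (g x) = 0.
  by move=> /grho ->.
have gI0 x : ~ qcube (const_mx (- rho)) (2 * rho) x -> complex.Im (g x) = 0.
  by move=> /grho ->.
have [d1 d10 U1] := compact_support_unif gR gR0 al40.
have [d2 d20 U2] := compact_support_unif gI gI0 al40.
exists (Num.min d1 d2); split; first by rewrite lt_min d10.
(* [L] bounds the volume of the cube from below, so that the cube of volume [(2 * rho) ^+ n] outside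
   which [g] vanishes takes less than [lam / 2 * l ^+ n]. *)
exists (((2 * rho) ^+ n + 1) / (lam / 2)), (rho : R) => a l l0.
set c := cmean (fun x => f x - g x) (qcube a l).
have rho20 : 0 < 2 * rho by rewrite mulr_gt0.
move=> [small|large|far].
- apply: (local_mean_osc_le (c := c + g a)) (le_lt_trans (Ch a l l0) (lt2 l l0)) => //.
  move=> x xa h; split=> //=; rewrite ltNge; apply/negP => h'; move: h.
  apply/negP; rewrite -leNgt.
  have -> : f x - (c + g a) = (f x - g x - c) + (g x - g a) by ring.
  apply: (le_trans (le_normcD _ _)).
  have xad i : `|x ord0 i - a ord0 i| <= l by rewrite ler_norml; have := xa i; lra.
  have : Normc.normc (g x - g a) <= al2.
    apply: (le_trans (normc_le _)); rewrite ReB ImB.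
    have h1 : `|complex.Re (g x) - complex.Re (g a)| <= al2 / 2.
      apply: U1 => i; apply: (le_trans (xad i)); apply: (le_trans small).
      by rewrite ge_min lexx.
    have h2 : `|complex.Im (g x) - complex.Im (g a)| <= al2 / 2.
      apply: U2 => i; apply: (le_trans (xad i)); apply: (le_trans small).
      by rewrite ge_min lexx orbT.
    by lra.
  by rewrite /al2 in h' *; rewrite /c in h' *; lra.
- pose K : set T := qcube (const_mx (- rho)) (2 * rho).
  pose E := [set x : T | (al2 < Normc.normc (f x - g x - c))%R] `&` qcube a l.
  apply: (@local_mean_osc_le _ _ c _ _ _ (E `|` K)) => //.
    move=> x xa h; have [xK|xK] := pselect (K x); [by right|left].
    split => //=; rewrite (grho x xK) subr0; apply: le_lt_trans h.
    by rewrite /al2; lra.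
  have muU : (mu (E `|` K) <= mu E + mu K)%E by exact: outer_measureU2.
  apply: (le_lt_trans muU).
  rewrite [X in (_ + X)%E](mu_qcube _ rho20).
  apply: (le_lt_trans (leeD (Ch a l l0) (lexx _))).
  rewrite -EFinD lte_fin; move: large.
  rewrite ler_pdivrMr ?divr_gt0//; lra.
- apply: (local_mean_osc_le (c := c)) (le_lt_trans (Ch a l l0) (lt2 l l0)) => //.
  move=> x xa h; split=> //=.
  rewrite (grho x) ?subr0; first by apply: le_lt_trans h; rewrite /al2; lra.
  move=> xK; suff : (qcube a l `&` centered_cube rho) x by rewrite far.
  by split=> // i; have := xK i; rewrite mxE; lra.
Qed.

Lemma cvg_ereal0 (F : set_system R) (G : R -> \bar R) : ProperFilter F ->
  (forall e, 0 < e -> \forall r \near F, (0 <= G r <= e%:E)%E) ->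
  G r @[r --> F] --> 0%:E.
Proof.
move=> FF H; apply/fine_cvgP.
have Gfin e r : (0 <= G r <= e%:E)%E -> G r \is a fin_num.
  by move=> /andP[G0 Ge]; rewrite ge0_fin_numE// (le_lt_trans Ge)// ltry.
split; first by near=> r; apply: (Gfin 1); near: r; exact: H.
apply/cvgrPdist_le => e e0; near=> r.
have Gr : (0 <= G r <= e%:E)%E by near: r; exact: H.
have Gf := Gfin e r Gr; move/andP: Gr => [G0 Ge].
by rewrite sub0r normrN /= ger0_norm ?fine_ge0// -lee_fin fineK.
Unshelve. all: by end_near. Qed.

Lemma CMO_vanishing lam f : (0 < n)%N -> 0 < lam -> CMO f ->
  [/\ ereal_sup [set local_mean_osc lam f Q | Q in
        [set Q | is_cube Q /\ mu Q = r%:E]] @[r --> 0^'+] --> 0%:E,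
      ereal_sup [set local_mean_osc lam f Q | Q in
        [set Q | is_cube Q /\ mu Q = r%:E]] @[r --> +oo] --> 0%:E &
      ereal_sup [set local_mean_osc lam f Q | Q in
        [set Q | is_cube Q /\ Q `&` centered_cube d = set0]] @[d --> +oo]
        --> 0%:E].
Proof.
move=> n0 lam0 fC.
have bnd (S : set (set 'rV[R]_n)) e : S !=set0 ->
    (forall Q, S Q -> (local_mean_osc lam f Q <= e%:E)%E) ->
    (0 <= ereal_sup [set local_mean_osc lam f Q | Q in S] <= e%:E)%E.
  move=> [Q SQ] H; apply/andP; split.
    apply: (le_trans (local_mean_osc_ge0 lam f Q)).
    by apply: ereal_sup_ubound; exists Q.
  by apply: ge_ereal_sup => _ [Q' SQ' <-]; exact: H.
(* The supremum of an empty family would be minus infinity and spoil the limit, so a cube of each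
   volume is exhibited, with the [n]-th root of [r] as side. *)
have ex r : 0 < r -> [set Q | @is_cube R n Q /\ mu Q = r%:E] !=set0.
  move=> r0; pose l := r `^ (n%:R^-1).
  have l0 : 0 < l by exact: powR_gt0.
  exists (qcube 0 l); split; first exact: is_cube_qcube.
  rewrite mu_qcube// -powR_mulrn ?powR_ge0// -powRrM mulVf ?powRr1// ?ltW//.
  by rewrite pnatr_eq0 -lt0n.
split; apply: cvg_ereal0 => e e0.
- have [r [r0 [L [d H]]]] := CMO_small_osc lam0 fC e0.
  near=> s; have s0 : 0 < s by near: s; exact: nbhs_right_gt.
  apply: bnd; first exact: ex.
  move=> _ [[a [l [l0 ->]]] ms]; apply: H => //; apply: Or31.
  have : (l ^+ n)%:E = s%:E by rewrite -ms; exact/esym/mu_qcube.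
  move=> [ls]; rewrite leNgt; apply/negP => rl.
  have : s < r ^+ n by near: s; apply: nbhs_right_lt; rewrite exprn_gt0.
  rewrite -ls ltNge => /negP; apply; apply: lerXn2r; rewrite ?nnegrE ltW//.
- have [r [r0 [L [d H]]]] := CMO_small_osc lam0 fC e0.
  near=> s; have s0 : 0 < s by near: s; exact: (nbhs_pinfty_gt (num_real _)).
  apply: bnd; first exact: ex.
  move=> _ [[a [l [l0 ->]]] ms]; apply: H => //; apply: Or32.
  have : (l ^+ n)%:E = s%:E by rewrite -ms; exact/esym/mu_qcube.
  by move=> [->]; near: s; exact: (nbhs_pinfty_ge (num_real _)).
- have [r [r0 [L [d H]]]] := CMO_small_osc lam0 fC e0.
  near=> s; have ds : d <= s by near: s; exact: (nbhs_pinfty_ge (num_real _)).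
  apply: bnd.
    exists (qcube (const_mx (s + 1)) 1); split; first exact: is_cube_qcube.
    rewrite -subset0 => x [xa xd].
    by have := xa (Ordinal n0); have := xd (Ordinal n0); rewrite mxE; lra.
  move=> _ [[a [l [l0 ->]]] Qd]; apply: H => //; apply: Or33.
  rewrite -subset0 => x [xa xd].
  suff : (qcube a l `&` centered_cube s) x by rewrite /qcube Qd.
  by split=> // i; have := xd i; lra.
Unshelve. all: by end_near. Qed.

End necessity.

Theorem theorem3p3 (R : realType) (n : nat) (n_gt0 : (0 < n)%N) (lambda : R)
    (lambda_gt0 : 0 < lambda) (lambda_lt : lambda < 2^-1)
    (f : 'rV[R]_n -> R[i]) (f_BMO : BMO f) :
  CMO f <->
  [/\ ereal_sup [set local_mean_osc lambda f Q | Q in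
        [set Q | is_cube Q /\ lebesgue_rV Q = r%:E]] @[r --> 0^'+] --> 0%:E,
      ereal_sup [set local_mean_osc lambda f Q | Q in
        [set Q | is_cube Q /\ lebesgue_rV Q = r%:E]] @[r --> +oo] --> 0%:E &
      ereal_sup [set local_mean_osc lambda f Q | Q in
        [set Q | is_cube Q /\ Q `&` centered_cube d = set0]] @[d --> +oo]
        --> 0%:E].
Proof.
split=> [fC|[c1 c2 c3]]; first exact: CMO_vanishing.
have [[[m1 m2] _] _] := f_BMO.
apply: (vanishing_osc_CMO n_gt0 lambda_gt0 lambda_lt f_BMO).
  exact: (vanishing_osc_part n_gt0 (@Re_le_normc R) (@ReB R) m1 c1 c2 c3).
exact: (vanishing_osc_part n_gt0 (@Im_le_normc R) (@ImB R) m2 c1 c2 c3).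
Qed.
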